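(* There is an absolute constant $C$ such that the following holds. Let $(X,\Pi)$ be a $d$-dimensional $\gamma$-non-lazy $(\delta,\gamma)$-eposet and let $M$ be a monotonic HD-walk on $C_k$, $k<d$. Then for all $0\le i\le k$ and $\tau\in X(i)$, \[\Phi(X_\tau)\in[1-\lambda_i(M)-c\gamma,\ 1-\lambda_i(M)+c\gamma],\] where $c\le C\frac{k^5R_{\max}^2(h(M)+k)h(M)w(M)}{\delta^k_{k-i}(1-\delta_{i-1})}$.
   Context: A $d$-dimensional graded poset is a poset $(X,<)$ with a rank function partitioning $X=X(0)\cup\dots\cup X(d)$, ranks increasing along $<$ and covers raising rank by one; $y\lessdot x$ means $y<x$ with rank$(x)=$rank$(y)+1$. Standing assumptions: $|X(0)|=1$, all maximal elements have rank $d$, and $X$ is regular: every $x\in X(k)$ is greater than exactly $R(k,i)$ elements of $X(i)$, and the number of maximal chains between comparable $x_k\in X(k)$, $x_i\in X(i)$ depends only on $k,i$. A probability distribution $\pi_d$ on $X(d)$ induces $\pi_i(x)=\frac{1}{R(i+1,i)}\sum_{y\gtrdot x}\pi_{i+1}(y)$. $C_k$ = real functions on $X(k)$, $\langle f,g\rangle=\sum_\tau\pi_k(\tau)f(\tau)g(\tau)$. $U_if(y)=\frac{1}{R(i+1,i)}\sum_{x\lessdot y}f(x)$, $D_{i+1}f(x)=\frac{\sum_{y\gtrdot x}\pi_{i+1}(y)f(y)}{\sum_{y\gtrdot x}\pi_{i+1}(y)}$. $(X,\Pi)$ is a $(\delta,\gamma)$-eposet ($\delta\in[0,1]^{d-1}$,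 $\gamma<1$) if $\|D_{i+1}U_i-(1-\delta_i)I-\delta_iU_{i-1}D_i\|\le\gamma$ for $1\le i\le d-1$; $\gamma$-non-lazy if for every $1\le i\le d$ and $\sigma\in X(i)$ the walk $U_{i-1}D_i$ returns from $\sigma$ to $\sigma$ with probability at most $\gamma$. Notation: $\delta^m_t=\prod_{r=m-t}^m\delta_r$ ($t\ge0$), $\delta^m_t=1$ ($t<0$); $R_{\max}=\max_{0\le i\le k}R(k,i)$. A pure walk $Y$ of height $h$ on $C_k$ is $Z_{2h}\circ\cdots\circ Z_1$ ($Z_1$ applied first) with $h$ up and $h$ down operators; if its down operators are at positions $i_1<\dots<i_h$, put $\lambda_{Y,\delta,\ell}=\prod_{s=1}^h(1-\delta^{k-2s+i_s}_{k-2s+i_s-\ell})$. An HD-walk is an affine combination $M=\sum\alpha_YY$ ($\sum\alpha_Y=1$) of pure walks on $C_k$ that is stochastic and self-adjoint; $h(M)$ = maximal height of $Y$ with $\alpha_Y\ne0$, $w(M)=\sum|\alpha_Y|$, and its approximate eigenvalues are $\lambda_\ell(M)=\sum\alpha_Y\lambda_{Y,\delta,\ell}$, $0\le\ell\le k$. $M$ is monotonic if $\lambda_0(M)\ge\lambda_1(M)\ge\dots\ge\lambda_k(M)$. Writing $M(v,y)$ for its transition probabilities ($Mf(v)=\sum_yM(v,y)f(y)$), the edge expansion of $S\subseteq X(k)$ is $\Phi(S)=\mathbb E_{v\sim\pi_k|_S}\big[\sum_{y\in X(k)\setminus S}M(v,y)\big]$, where $\pi_k|_S$ is $\pi_k$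 conditioned on $S$. For $\tau\in X(i)$, $X_\tau=\{y\in X(k):y>\tau\}$. *)

(* Defs.v *)
From mathcomp Require Import all_boot all_order all_algebra.
From mathcomp Require Import all_classical all_reals.

Set Implicit Arguments.
Unset Strict Implicit.
Unset Printing Implicit Defensive.

Import Order.TTheory GRing.Theory Num.Theory.
Local Open Scope ring_scope.

Section Poset.
Context (disp : Order.disp_t) (X : finPOrderType disp).
Variables (d : nat) (rank : X -> nat).

Definition lessdot (y x : X) : bool := (y < x)%O && (rank x == (rank y).+1).

Definition graded : Prop :=
  [/\ forall x, (rank x <= d)%N,
      forall x y, (x < y)%O -> (rank x < rank y)%N
    & forall x y, (x < y)%O -> (forall z, ~~ (x < z < y)%O) ->
        rank y = (rank x).+1].

Definition is_chain (B : {set X}) : bool :=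
  [forall a in B, forall b in B, (a >=< b)%O].

Definition max_chains (x y : X) : {set {set X}} :=
  [set B | maxset (fun A : {set X} =>
             (A \subset [set z | (x <= z <= y)%O]) && is_chain A) B].

(* [nb k i] is R(k,i). *)
Definition regular (nb : nat -> nat -> nat) : Prop :=
  (forall (x : X) (i : nat),
     #|[set y | (y < x)%O & rank y == i]| = nb (rank x) i) /\
  (forall x y x' y' : X, (x < y)%O -> (x' < y')%O ->
     rank x = rank x' -> rank y = rank y' ->
     #|max_chains x y| = #|max_chains x' y'|).

Definition regular_graded_poset (nb : nat -> nat -> nat) : Prop :=
  [/\ graded,
      #|[set x | rank x == 0%N]| = 1%N,
      forall x, (forall y, ~~ (x < y)%O) -> rank x = d
    & regular nb].

Definition level (k : nat) := {x : X | rank x == k}.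

(* X_tau as a subset of X(k). The order is taken non-strictly, which matters
   only when tau has rank k: then X_tau = {tau}, whereas the strict order would
   give the empty set, on which edge expansion is undefined. *)
Definition above (i k : nat) (tau : level i) : {set level k} :=
  [set y : level k | (val tau <= val y)%O].

End Poset.

Definition Rmax (nb : nat -> nat -> nat) (k : nat) : nat :=
  \max_(i < k.+1) nb k i.

(* The types of the constructors make the sequences of operators composable:
   no step goes below rank 0 or above rank d. *)
Inductive walk (d k : nat) : nat -> Type :=
  | Stay : walk d k k
  | Up (j : nat) of walk d k j & (j < d)%N : walk d k j.+1
  | Down (j : nat) of walk d k j.+1 : walk d k j.

(* true for an up operator, false for a down operator, in order of
   application *)
Fixpoint letters (d k j : nat) (Y : walk d k j) : seq bool :=
  match Y with
  | Stay => [::]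
  | Up _ Y' _ => rcons (letters Y') true
  | Down _ Y' => rcons (letters Y') false
  end.

(* 1-based *)
Definition down_positions (d k j : nat) (Y : walk d k j) : seq nat :=
  [seq p <- iota 1 (size (letters Y)) | ~~ nth true (letters Y) p.-1].

Definition height (d k : nat) (Y : walk d k k) : nat :=
  size (down_positions Y).

Section Delta.
Variables (R : realType) (d : nat) (delta : d.-1.-tuple R).

(* delta_r for 1 <= r <= d-1, extended by delta_0 = 0: since X(0) is a
   singleton, D_1 U_0 is the identity of C_0. *)
Definition dlt (r : nat) : R := if r is r'.+1 then nth 0 delta r' else 0.

(* delta^m_{m-l}; the product is empty when m < l *)
Definition dltprod (m l : nat) : R := \prod_(l <= r < m.+1) dlt r.

(* The bigop index s is 0-based, so that k-2s+i_s becomes the following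
   subtraction; it is the rank reached by the down operator concerned, and the
   subtraction never truncates. *)
Definition walk_eigenvalue (k : nat) (Y : walk d k k) (l : nat) : R :=
  \prod_(s < height Y)
    (1 - dltprod (k + nth 0%N (down_positions Y) s - 2 * s.+1) l).

End Delta.

Record affine_walk (R : realType) (d k : nat) := AffineWalk {
  aw_size : nat;
  aw_walk : 'I_aw_size -> walk d k k;
  aw_coef : 'I_aw_size -> R;
  aw_inj : injective aw_walk;
  aw_sum1 : \sum_j aw_coef j = 1
}.

Section AffineWalk.
Variables (R : realType) (d k : nat) (M : affine_walk R d k).

Definition aw_height : nat :=
  \max_(j < aw_size M | aw_coef j != 0) height (aw_walk j).

Definition aw_weight : R := \sum_(j < aw_size M) `|aw_coef j|.

Definition aw_eigenvalue (delta : d.-1.-tuple R) (l : nat) : R :=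
  \sum_(j < aw_size M) aw_coef j * walk_eigenvalue delta (aw_walk j) l.

Definition monotonic (delta : d.-1.-tuple R) : Prop :=
  forall l, (l < k)%N -> aw_eigenvalue delta l.+1 <= aw_eigenvalue delta l.

End AffineWalk.

Section Operators.
Context (disp : Order.disp_t) (X : finPOrderType disp).
Variables (R : realType) (d : nat) (rank : X -> nat).
Variables (nb : nat -> nat -> nat) (pi : X -> R).

Local Notation level := (level rank).
Local Notation lessdot := (lessdot rank).

(* The levels being disjoint, one function pi : X -> R carries all the pi_i.
   The second clause says that the denominators in the definition of the down
   operators do not vanish; it does not constrain the support of pi_d
   further. *)
Definition measured : Prop :=
  [/\ forall x, 0 <= pi x,
      forall x, (rank x < d)%N -> 0 < pi x,
      \sum_(x | rank x == d) pi x = 1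
    & forall x, (rank x < d)%N ->
        pi x = (nb (rank x).+1 (rank x))%:R^-1 * \sum_(y | lessdot x y) pi y].

Definition cochain (k : nat) := {ffun level k -> R}.

Definition indic (k : nat) (y : level k) : cochain k :=
  [ffun x => (x == y)%:R].

Definition inner (k : nat) (f g : cochain k) : R :=
  \sum_(x : level k) pi (val x) * f x * g x.

Definition cnorm (k : nat) (f : cochain k) : R := Num.sqrt (inner f f).

Definition opnorm (k : nat) (A : cochain k -> cochain k) : R :=
  sup [set cnorm (A f) | f in [set f | cnorm f <= 1]]%classic.

(* [upop i] is U_i and [downop i] is D_{i+1}. *)
Definition upop (i : nat) (f : cochain i) : cochain i.+1 :=
  [ffun y : level i.+1 => (nb i.+1 i)%:R^-1 *
     \sum_(x : level i | lessdot (val x) (val y)) f x].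

Definition downop (i : nat) (f : cochain i.+1) : cochain i :=
  [ffun x : level i =>
     (\sum_(y : level i.+1 | lessdot (val x) (val y)) pi (val y) * f y) /
     (\sum_(y : level i.+1 | lessdot (val x) (val y)) pi (val y))].

Definition transition (k : nat) (A : cochain k -> cochain k) (v y : level k) : R :=
  A (indic y) v.

(* Below, the index i of the definition in the literature is j.+1. *)
Definition eposet (delta : d.-1.-tuple R) (gamma : R) : Prop :=
  [/\ forall r : 'I_d.-1, 0 <= tnth delta r <= 1,
      gamma < 1
    & forall j, (j.+1 < d)%N ->
        opnorm (fun f : cochain j.+1 =>
          [ffun x => downop (upop f) x - (1 - dlt delta j.+1) * f x
                     - dlt delta j.+1 * upop (downop f) x]) <= gamma].

Definition non_lazy (gamma : R) : Prop :=
  forall j, (j < d)%N -> forall sigma : level j.+1,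
    transition (fun f => upop (downop f)) sigma sigma <= gamma.

Fixpoint walk_op (k j : nat) (Y : walk d k j) : cochain k -> cochain j :=
  match Y with
  | Stay => fun f => f
  | Up _ Y' _ => fun f => upop (walk_op Y' f)
  | Down _ Y' => fun f => downop (walk_op Y' f)
  end.

Definition aw_op (k : nat) (M : affine_walk R d k) (f : cochain k) : cochain k :=
  [ffun v => \sum_(j < aw_size M) aw_coef j * walk_op (aw_walk j) f v].

Definition stochastic (k : nat) (A : cochain k -> cochain k) : Prop :=
  (forall v y, 0 <= transition A v y) /\
  (forall v, \sum_y transition A v y = 1).

Definition self_adjoint (k : nat) (A : cochain k -> cochain k) : Prop :=
  forall f g, inner (A f) g = inner f (A g).

Definition hd_walk (k : nat) (M : affine_walk R d k) : Prop :=
  stochastic (aw_op M) /\ self_adjoint (aw_op M).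

Definition expansion (k : nat) (A : cochain k -> cochain k)
    (S : {set level k}) : R :=
  (\sum_(v in S) pi (val v) * \sum_(y in ~: S) transition A v y) /
  (\sum_(v in S) pi (val v)).

End Operators.

(* Main.v *)
(* Let g be the indicator of tau, of rank i. By regularity the indicator of
   X_tau is proportional to f = U^(k-i) g, so that Phi(X_tau) is 1 minus the
   Rayleigh quotient of M at f. Commuting the down operators of a pure walk past
   the up operators with D U = (1 - delta) I + delta U D + O(gamma), one rewrites
   D^(k-i) Y U^(k-i) g, up to an error O(gamma |g|), as a convex combination of
   g, with weight lambda_{Y,i} p, where p is the weight found for Y = I, and of
   the vectors U^l D^l g with l > 0. The inner product of the latter with g is
   |D^l g|^2 <= |D g|^2, which non-laziness bounds by gamma |g|^2. Finally
   |f|^2 = |g|^2 / R(k, i) exactly, so no lower bound on the eigenvalues is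
   needed. *)
From HB Require Import structures.
Require Import Defs.
From mathcomp Require Import all_boot all_order all_algebra.
From mathcomp Require Import all_classical all_reals.
(* fintype and finset come last: otherwise the classical_sets lemmas shadow
   those on {set _}. *)
From mathcomp Require Import fintype finset zify ring lra.

Set Implicit Arguments.
Unset Strict Implicit.
Unset Printing Implicit Defensive.

Import Order.TTheory GRing.Theory Num.Theory.
Local Open Scope ring_scope.

(** * Maximal chains and regularity *)

(** The remainder must be a convex combination, not merely a linear one: its terms are then bounded
    by the largest of them, and the error stays polynomial in the height although the number of
    terms grows with every down operator. This rests on each [delta_r] lying in [0, 1]. A down
    operator that meets [U^(n+1) (D^l g)] either cancels one up operator or passes them all and
    increases [l]. The vector [g] survives only if a cancellation occurs every time, and the weight
    of a cancellation at the rank [j] reached, [1 - dltprod delta j i], depends on [j] alone. The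
    weight of [g] is therefore multiplicative along the word: the letters of the walk contribute its
    eigenvalue, the closing down operators a factor common to all walks. That factor may be small,
    so it is never divided out: the estimate for the empty walk is multiplied by the eigenvalue,
    which lies in [0, 1], and subtracted. Rank 0 stands apart, since no [D g] exists there. *)

Section Chains.
Context (disp : Order.disp_t) (X : finPOrderType disp).
Variables (d : nat) (rank : X -> nat) (nb : nat -> nat -> nat).
Hypothesis posetX : regular_graded_poset d rank nb.

Let rank_lt (x y : X) : (x < y)%O -> (rank x < rank y)%N.
Proof. by case: posetX => -[_ h _] _ _ _; apply: h. Qed.

Let rank_le (x y : X) : (x <= y)%O -> (rank x <= rank y)%N.
Proof. by rewrite le_eqVlt => /orP[/eqP->//|/rank_lt/ltnW]. Qed.

Lemma le_rank_eq (x y : X) : (x <= y)%O -> rank x = rank y -> x = y.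
Proof.
rewrite le_eqVlt => /orP[/eqP//|/rank_lt h e].
by rewrite e ltnn in h.
Qed.

Let chainP (B : {set X}) :
  reflect (forall a b, a \in B -> b \in B -> (a >=< b)%O) (is_chain B).
Proof.
apply: (iffP forall_inP) => [h a b aB bB|h a aB].
  by have /forall_inP := h a aB; apply.
by apply/forall_inP => b; apply: h.
Qed.

(** Maximality can be tested on one element at a time: an outside [z] of the interval comparable
    with all of [B] would extend the chain. *)
Lemma max_chainsP (x y : X) (B : {set X}) :
  reflect [/\ B \subset [set z | (x <= z <= y)%O], is_chain B
    & forall z, (x <= z <= y)%O -> (forall b, b \in B -> (z >=< b)%O) -> z \in B]
  (B \in max_chains x y).
Proof.
rewrite inE; apply: (iffP maxsetP) => [[/andP[sB cB] mB]|[sB cB mB]].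
  split=> // z zxy zB.
  rewrite -(mB (z |: B)) ?setU11 ?subsetUr //.
  rewrite subUset sub1set inE zxy sB /=.
  apply/chainP => a b; rewrite !inE => /orP[/eqP->|aB] /orP[/eqP->|bB].
  - by rewrite /Order.comparable lexx.
  - exact: zB.
  - by rewrite comparable_sym; apply: zB.
  - exact: (chainP _ cB).
split=> [|A /andP[sA cA] BA]; first by rewrite sB.
apply/eqP; rewrite eqEsubset BA andbT; apply/subsetP => z zA.
apply: mB => [|b bB]; first by have := subsetP sA z zA; rewrite inE.
by apply: (chainP _ cA) => //; apply: (subsetP BA).
Qed.

Lemma max_chains_neq0 (x y : X) : (0 < #|max_chains x y|)%N.
Proof.
apply/card_gt0P.
have [|B mB _] := @maxset_exists _ (fun A : {set X} =>
   (A \subset [set z | (x <= z <= y)%O]) && is_chain A) set0.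
  by rewrite sub0set; apply/chainP => a b; rewrite inE.
by exists B; rewrite inE.
Qed.

Lemma rank_between (x y z : X) : lessdot rank x y -> (x <= z <= y)%O ->
  z = x \/ z = y.
Proof.
move=> /andP[_ /eqP rxy] /andP[xz zy].
move: xz zy; rewrite !le_eqVlt.
case/orP => [/eqP->|xz]; first by left.
case/orP => [/eqP->|zy]; first by right.
by have := rank_lt xz; have := rank_lt zy; lia.
Qed.

(* A maximal chain of [t, y] is [y] added to a maximal chain of [t, x], where
   [x] is the largest element below [y] of the chain. *)
Lemma card_max_chains (t y : X) : (t < y)%O ->
  #|max_chains t y| =
    \sum_(x | lessdot rank x y && (t <= x)%O) #|max_chains t x|.
Proof.
move=> ty.
(* Double count the pairs of a maximal chain and a lower cover of [y] on it: each chain contains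
   exactly one. *)
transitivity (\sum_(B in max_chains t y)
    \sum_(x | lessdot rank x y && (t <= x)%O) (x \in B : nat)).
  rewrite -sum1_card; apply: eq_bigr => B /max_chainsP[sB cB mB].
  have inB z : z \in B -> (t <= z <= y)%O by move/(subsetP sB); rewrite inE.
  have tB : t \in B.
    apply: mB => [|b /inB/andP[tb _]]; first by rewrite lexx ltW.
    by rewrite /Order.comparable tb.
  have yB : y \in B.
    apply: mB => [|b /inB/andP[_ yb]]; first by rewrite lexx ltW.
    by rewrite /Order.comparable yb orbT.
  have tBy : t \in B :\ y by rewrite !inE tB lt_eqF.
  have [x xBy xmax] := @arg_maxnP _ t (mem (B :\ y)) rank tBy.
  move: (xBy); rewrite !inE => /andP[xy xB].
  have /andP[tx xley] := inB _ xB.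
  have ltxy : (x < y)%O by rewrite lt_neqAle xy.
  have lex z : z \in B -> z != y -> (z <= x)%O.
    move=> zB zy; have /orP[//|] := chainP _ cB z x zB xB.
    rewrite le_eqVlt => /orP[/eqP->//|/rank_lt xz].
    have : (rank z <= rank x)%N by apply: (xmax z); rewrite !inE zy.
    by rewrite leqNgt xz.
  have cov : lessdot rank x y.
    rewrite /lessdot ltxy; case: posetX => -[_ _ h] _ _ _.
    apply/eqP/(h x y ltxy) => z; apply/negP => /andP[xz zy].
    have zB : z \in B.
      apply: mB => [|b bB].
        by rewrite (le_trans tx (ltW xz)) (ltW zy).
      have [->|b_y] := eqVneq b y; first by rewrite /Order.comparable ltW.
      by rewrite /Order.comparable (le_trans (lex b bB b_y) (ltW xz)) orbT.
    have := lex z zB; rewrite lt_eqF// => /(_ isT) zx.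
    by have := lt_le_trans xz zx; rewrite ltxx.
  rewrite (bigD1 x) /= ?cov ?tx// xB big1 // => z /andP[/andP[zy tz] zx].
  apply/eqP; rewrite eqb0; apply/negP => zB.
  have z_y : z != y by case/andP: zy => /lt_eqF->.
  have zlex := lex z zB z_y.
  have : (z <= x <= y)%O by rewrite zlex.
  by case/(rank_between zy) => /eqP; [rewrite eq_sym (negPf zx)|rewrite (negPf xy)].
rewrite exchange_big /=; apply: eq_bigr => x /andP[xy tx].
have ltxy : (x < y)%O by case/andP: xy.
have notin A : A \in max_chains t x -> y \notin A.
  case/max_chainsP => sA _ _; apply/negP => /(subsetP sA); rewrite inE.
  by case/andP => _ yx; have := lt_le_trans ltxy yx; rewrite ltxx.
rewrite -big_mkcondr /= sum1dep_card.
transitivity #|[set y |: A | A in max_chains t x]|; last first.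
  rewrite card_in_imset // => A B /notin yA /notin yB eAB.
  by rewrite -(setU1K yA) eAB setU1K.
apply: eq_card => B; rewrite !inE; apply/andP/imsetP.
  move=> [mB xB]; have /max_chainsP[sB cB {}mB] : B \in max_chains t y.
    by rewrite inE.
  have inB z : z \in B -> (t <= z <= y)%O by move/(subsetP sB); rewrite inE.
  have yB : y \in B.
    apply: mB => [|b /inB/andP[_ yb]]; first by rewrite lexx ltW.
    by rewrite /Order.comparable yb orbT.
  exists (B :\ y); last by rewrite setD1K.
  have lex z : z \in B -> z != y -> (z <= x)%O.
    move=> zB zy; have /orP[//|xz] := chainP _ cB z x zB xB.
    have : (x <= z <= y)%O by rewrite xz; case/andP: (inB _ zB).
    by case/(rank_between xy) => e; rewrite e ?eqxx in zy *.
  apply/max_chainsP; split.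
  - apply/subsetP => z; rewrite !inE => /andP[zy zB].
    by rewrite lex // andbT; case/andP: (inB _ zB).
  - apply/chainP => a b; rewrite !inE => /andP[_ aB] /andP[_ bB].
    exact: (chainP _ cB).
  - move=> z /andP[tz zx] zB.
    have zy : (z < y)%O := le_lt_trans zx ltxy.
    rewrite !inE (lt_eqF zy) /=; apply: mB => [|b bB].
      by rewrite tz ltW.
    have [->|b_y] := eqVneq b y; first by rewrite /Order.comparable ltW.
    by apply: zB; rewrite !inE b_y.
move=> [A /max_chainsP[sA cA mA] ->{B}].
have inA z : z \in A -> (t <= z <= x)%O by move/(subsetP sA); rewrite inE.
have xA : x \in A.
  apply: mA => [|b /inA/andP[_ xb]]; first by rewrite lexx tx.
  by rewrite /Order.comparable xb orbT.
split; last by rewrite !inE xA orbT.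
suff : y |: A \in max_chains t y by rewrite inE.
apply/max_chainsP; split.
- rewrite subUset sub1set inE lexx (ltW ty) /=.
  apply/subsetP => z /inA/andP[tz zx]; rewrite inE tz /=.
  exact: le_trans zx (ltW ltxy).
- have yA z : z \in A -> (z <= y)%O.
    by case/inA/andP => _ zx; apply: le_trans zx (ltW ltxy).
  apply/chainP => a b; rewrite !inE => /orP[/eqP->|aA] /orP[/eqP->|bA].
  + by rewrite /Order.comparable lexx.
  + by rewrite /Order.comparable (yA _ bA) orbT.
  + by rewrite /Order.comparable (yA _ aA).
  + exact: (chainP _ cA).
- move=> z /andP[tz zy] zA; rewrite !inE.
  have [//|z_y] := eqVneq z y.
  apply: mA => [|b bA]; last by apply: zA; rewrite !inE bA orbT.
  rewrite tz; have := zA x; rewrite !inE xA orbT => /(_ isT)/orP[//|xz].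
  have : (x <= z <= y)%O by rewrite xz.
  by case/(rank_between xy) => e; rewrite e ?eqxx ?lexx // in z_y *.
Qed.

(* R(m, i), completed by the value 1 for m = i. *)
Definition nbe (m i : nat) : nat := if m == i then 1%N else nb m i.

Lemma card_le_rank (x : X) (i : nat) :
  (i <= rank x)%N -> #|[set t | (t <= x)%O & rank t == i]| = nbe (rank x) i.
Proof.
rewrite /nbe leq_eqVlt => /orP[/eqP->|lt_i].
  rewrite eqxx -(cards1 x); apply: eq_card => t; rewrite !inE.
  apply/andP/eqP => [[tx /eqP]|->]; last by split.
  exact: le_rank_eq.
rewrite gtn_eqF //; case: posetX => _ _ _ [h _]; rewrite -h.
apply: eq_card => t; rewrite !inE le_eqVlt.
case: (eqVneq t x) => [->|//] /=.
by rewrite ltxx gtn_eqF.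
Qed.

Let covers (t y : X) := [set x | lessdot rank x y & (t <= x)%O].

Lemma card_covers_gt0 (t y : X) : (t < y)%O ->
  (0 < #|[set x | lessdot rank x y & (t <= x)%O]|)%N.
Proof.
move=> ty; rewrite lt0n; apply/eqP => /eqP; rewrite cards_eq0 => /eqP c0.
have := max_chains_neq0 t y; rewrite card_max_chains // big_pred0 // => x.
by have := in_set0 x; rewrite -c0 inE.
Qed.

(** All these [x] have equally many maximal chains down to [t], so the count is a quotient of two
    chain numbers that depend on ranks only. Regularity of chain numbers concerns strict pairs,
    hence the separate case where [y] covers [t]. *)
Let card_covers (t u y : X) : (t < y)%O -> (u < y)%O -> rank t = rank u ->
  #|covers t y| = #|covers u y|.
Proof.
move=> ty uy rtu; case: (posetX) => _ _ _ [_ reg].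
have [x] := card_gt0P (card_covers_gt0 ty); rewrite inE => /andP[xy tx].
have [rx|rx] := eqVneq (rank x) (rank t).
  have one v : rank v = rank t -> (v < y)%O -> covers v y = [set v].
    move=> rv vy; apply/setP => z; rewrite !inE.
    apply/andP/eqP => [[/andP[_ /eqP rz] vz]|->].
      symmetry; apply: le_rank_eq vz _.
      by case/andP: xy => _ /eqP; rewrite rz rv rx => -[].
    by rewrite lexx /lessdot vy; case/andP: xy => _; rewrite rx rv.
  by rewrite !one // !cards1.
have ltx v z : rank v = rank t -> lessdot rank z y -> (v <= z)%O -> (v < z)%O.
  move=> rv /andP[_ /eqP rz] vz; rewrite lt_neqAle vz andbT.
  apply: contra_neq rx => e; case/andP: xy => _ /eqP; rewrite rz -rv e.
  by case.
have key v : rank v = rank t -> (v < y)%O ->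
    (#|covers v y| * #|max_chains t x| = #|max_chains v y|)%N.
  move=> rv vy; rewrite (card_max_chains vy) -sum_nat_const.
  apply: eq_big => [z|z /[1!inE] /andP[zy vz]].
    by rewrite inE.
  apply: reg => //; [exact: ltx xy tx|exact: ltx zy vz|].
  by case/andP: xy; case/andP: zy => _ /eqP-> _ /eqP[].
apply/eqP; rewrite -(eqn_pmul2r (max_chains_neq0 t x)) !key //.
by apply/eqP; apply: reg.
Qed.

(** Double counting of the pairs [u <= x] with [x] a lower cover of [y] and [u] of the rank of [t];
    each [u] contributes as much as [t]. It yields the proportion of lower covers of [y] that lie
    above [t]. *)
Lemma covers_mul (t y : X) (m : nat) : (t < y)%O -> rank y = m.+1 ->
  (#|[set x | lessdot rank x y & (t <= x)%O]| * nbe m.+1 (rank t) =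
   nb m.+1 m * nbe m (rank t))%N.
Proof.
move=> ty ry; have tm : (rank t <= m)%N by have := rank_lt ty; rewrite ry.
have cnt : #|[set x | lessdot rank x y]| = nb m.+1 m.
  case: posetX => _ _ _ [h _]; rewrite -ry -(h y m); apply: eq_card => x.
  by rewrite !inE /lessdot ry eqSS eq_sym.
rewrite -{1}ry -card_le_rank; last by rewrite ry ltnW.
rewrite mulnC -sum_nat_const -cnt -sum_nat_const.
under eq_bigr => u /[1!inE] /andP[uy /eqP ru].
  have uy' : (u < y)%O.
    rewrite lt_neqAle uy andbT; apply/eqP => e; move: (rank_lt ty).
    by rewrite -ru e ltnn.
  rewrite (card_covers ty uy' (esym ru)) -sum1_card.
  over.
rewrite /=.
transitivity (\sum_(u in [set u | (u <= y)%O & rank u == rank t])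
   \sum_(x in [set x | lessdot rank x y]) ((u <= x)%O : nat))%N.
  apply: eq_bigr => u _; rewrite -[RHS]big_mkcondr /=.
  by apply: eq_bigl => x; rewrite !inE.
rewrite exchange_big /=; apply: eq_bigr => x /[1!inE] xy.
case/andP: (xy) => ltxy; rewrite ry eqSS => /eqP rx.
rewrite rx -card_le_rank -?rx // -sum1dep_card.
have le u : (u <= x)%O -> (u <= y)%O by move/le_trans; apply; exact: ltW.
rewrite big_mkcond [RHS]big_mkcond /=.
apply: eq_bigr => u _; rewrite inE.
case ux : (u <= x)%O; first by rewrite (le _ ux) /=; case: eqP.
by rewrite /= !if_same.
Qed.

Lemma nbe_gt0 (t y : X) : (t <= y)%O -> (0 < nbe (rank y) (rank t))%N.
Proof.
move=> ty; rewrite -card_le_rank ?rank_le //; apply/card_gt0P.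
by exists t; rewrite inE ty eqxx.
Qed.

End Chains.

(** * Up and down operators on functions on the whole poset *)

Section LevelOperators.
Context (disp : Order.disp_t) (X : finPOrderType disp).
Variables (R : realType) (rank : X -> nat).
Variables (nb : nat -> nat -> nat) (pi : X -> R).

Local Notation lessdot := (lessdot rank).
Local Notation fctX := {ffun X -> R^o}.

(* A function on X carries all levels at once, which avoids cochains of
   dependent type: at rank j + 1, [upX F] depends only on F at rank j. *)
Definition upX (F : fctX) : fctX :=
  [ffun y => (nb (rank y) (rank y).-1)%:R^-1 * \sum_(x | lessdot x y) (F x : R)].

Definition downX (F : fctX) : fctX :=
  [ffun x => (\sum_(y | lessdot x y) pi y * F y) / \sum_(y | lessdot x y) pi y].

Fact upX_is_linear : linear upX.
Proof.
move=> a F G; apply/ffunP => y; rewrite !ffunE scalerAr -mulrDr scaler_sumr.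
by rewrite -big_split; congr (_ * _); apply: eq_bigr => x _; rewrite !ffunE.
Qed.
HB.instance Definition _ := GRing.isLinear.Build R fctX fctX *:%R upX upX_is_linear.

Fact downX_is_linear : linear downX.
Proof.
move=> a F G; apply/ffunP => y; rewrite !ffunE scalerAl -mulrDl scaler_sumr.
rewrite -big_split; congr (_ / _); apply: eq_bigr => x _; rewrite !ffunE.
by rewrite mulrDr scalerAr.
Qed.
HB.instance Definition _ :=
  GRing.isLinear.Build R fctX fctX *:%R downX downX_is_linear.

Definition ip (j : nat) (F G : fctX) : R :=
  \sum_(x | rank x == j) pi x * F x * G x.

Definition nrm (j : nat) (F : fctX) : R := Num.sqrt (ip j F F).

Lemma ipC j F G : ip j F G = ip j G F.
Proof. by apply: eq_bigr => x _; ring. Qed.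

Lemma ipDl j F G H : ip j (F + G) H = ip j F H + ip j G H.
Proof.
by rewrite -big_split; apply: eq_bigr => x _; rewrite !ffunE /=; ring.
Qed.

Lemma ipZl j a F G : ip j (a *: F) G = a * ip j F G.
Proof.
by rewrite mulr_sumr; apply: eq_bigr => x _; rewrite !ffunE /GRing.scale/=; ring.
Qed.

Lemma ipDr j F G H : ip j H (F + G) = ip j H F + ip j H G.
Proof. by rewrite ipC ipDl !(ipC _ H). Qed.

Lemma ipZr j a F G : ip j G (a *: F) = a * ip j G F.
Proof. by rewrite ipC ipZl ipC. Qed.

Lemma ipNl j F G : ip j (- F) G = - ip j F G.
Proof. by rewrite -scaleN1r ipZl mulN1r. Qed.

Lemma ipBl j F G H : ip j (F - G) H = ip j F H - ip j G H.
Proof. by rewrite ipDl ipNl. Qed.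

Hypothesis pi_ge0 : forall x, 0 <= pi x.

Lemma ip_ge0 j F : 0 <= ip j F F.
Proof.
by apply: sumr_ge0 => x _; rewrite -mulrA mulr_ge0 // -expr2 sqr_ge0.
Qed.

Lemma nrm_ge0 j F : 0 <= nrm j F. Proof. exact: sqrtr_ge0. Qed.

Lemma sqr_nrm j F : nrm j F ^+ 2 = ip j F F.
Proof. by rewrite sqr_sqrtr ?ip_ge0. Qed.

Lemma ip_cauchy_schwarz j F G : ip j F G ^+ 2 <= ip j F F * ip j G G.
Proof.
have pos t : 0 <= ip j F F - t * (2 * ip j F G) + t ^+ 2 * ip j G G.
  have := ip_ge0 j (F + (- t) *: G).
  rewrite !(ipDl, ipDr, ipZl, ipZr) (ipC j G F).
  by congr (0 <= _); ring.
have [c0|c0] := eqVneq (ip j G G) 0.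
  have [->|b0] := eqVneq (ip j F G) 0; first by rewrite c0 expr2 !mulr0.
  (* The form is only semi-definite, so [G] may be null. Then [pos] is affine in its argument, and
     at this point it would assert [0 <= -1]. *)
  have := pos ((ip j F F + 1) / (2 * ip j F G)).
  by rewrite c0 mulr0 addr0 divfK ?mulf_neq0 ?pnatr_eq0 //; lra.
have c_gt0 : 0 < ip j G G by rewrite lt_neqAle eq_sym c0 ip_ge0.
have := pos (ip j F G / ip j G G); rewrite -(pmulr_lge0 _ c_gt0).
suff -> : (ip j F F - ip j F G / ip j G G * (2 * ip j F G) +
  (ip j F G / ip j G G) ^+ 2 * ip j G G) * ip j G G =
  ip j F F * ip j G G - ip j F G ^+ 2 by rewrite subr_ge0.
by field.
Qed.

Lemma ip_le_nrm j F G : `|ip j F G| <= nrm j F * nrm j G.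
Proof.
rewrite -[leLHS]sqrtr_sqr -sqrtrM ?ip_ge0 // ler_wsqrtr //.
exact: ip_cauchy_schwarz.
Qed.

Lemma nrmD j F G : nrm j (F + G) <= nrm j F + nrm j G.
Proof.
have h : 0 <= nrm j F + nrm j G by rewrite addr_ge0 ?nrm_ge0.
rewrite -(@ler_pXn2r _ 2) ?nnegrE ?nrm_ge0 // sqr_nrm.
rewrite !(ipDl, ipDr) sqrrD !sqr_nrm (ipC j G F).
by have := ip_le_nrm j F G; rewrite ler_norml => /andP[_]; lra.
Qed.

Lemma nrmZ j a F : nrm j (a *: F) = `|a| * nrm j F.
Proof. by rewrite /nrm ipZl ipZr mulrA -expr2 sqrtrM ?sqr_ge0 // sqrtr_sqr. Qed.

Lemma nrmN j F : nrm j (- F) = nrm j F.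
Proof. by rewrite -scaleN1r nrmZ normrN1 mul1r. Qed.

Lemma nrm0 j : nrm j 0 = 0.
Proof. by rewrite -(scale0r 0) nrmZ normr0 mul0r. Qed.

Section Measured.
Variable d : nat.
Hypothesis posetX : regular_graded_poset d rank nb.
Hypothesis measX : measured d rank nb pi.

Let card_lessdot (y : X) : (0 < rank y)%N ->
  #|[set x | lessdot x y]| = nb (rank y) (rank y).-1.
Proof.
move=> y0; case: posetX => _ _ _ [h _]; rewrite -h; apply: eq_card => x.
rewrite !inE /Defs.lessdot; case: (rank y) y0 => // n _.
by rewrite eqSS eq_sym.
Qed.

Lemma pi_up_gt0 (x : X) : (rank x < d)%N -> 0 < \sum_(y | lessdot x y) pi y.
Proof.
move=> xd; case: measX => _ pos _ /(_ _ xd) e.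
rewrite lt_neqAle sumr_ge0 // andbT; apply/eqP => e0.
by have := pos _ xd; rewrite e -e0 mulr0 ltxx.
Qed.

(** Both sides are the sum of [F x * G y] over covering pairs with weight [pi y] divided by the
    number of lower covers; on the right, the induced formula for [pi x] cancels the denominator of
    [downX]. *)
Lemma ip_upX j F G : (j < d)%N -> ip j.+1 (upX F) G = ip j F (downX G).
Proof.
move=> jd.
transitivity (\sum_(y | rank y == j.+1) \sum_(x | rank x == j)
   (lessdot x y)%:R * ((nb j.+1 j)%:R^-1 * pi y * F x * G y)).
  apply: eq_bigr => y /eqP ry; rewrite ffunE ry /= mulrA mulr_sumr mulr_suml.
  rewrite [RHS](bigID (fun x => lessdot x y)) /= [X in _ = _ + X]big1 ?addr0.
    apply: eq_big => x; last by move=> ->; rewrite mul1r; ring.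
    by rewrite /Defs.lessdot ry eqSS [j == _]eq_sym; case: eqP; rewrite ?andbF.
  by move=> x /andP[_ /negPf->]; rewrite mul0r.
rewrite exchange_big /=; apply: eq_bigr => x /eqP rx.
case: (measX) => _ _ _ /(_ x); rewrite rx jd => /(_ isT) e.
rewrite ffunE [pi x]e; have s0 : \sum_(y | lessdot x y) pi y != 0.
  by rewrite gt_eqF // pi_up_gt0 // rx.
have -> : (nb j.+1 j)%:R^-1 * (\sum_(y | lessdot x y) pi y) * F x *
    ((\sum_(y | lessdot x y) pi y * G y) / \sum_(y | lessdot x y) pi y) =
  (nb j.+1 j)%:R^-1 * F x * \sum_(y | lessdot x y) pi y * G y.
  by rewrite -[in RHS](divfK s0 (\sum_(y | lessdot x y) pi y * G y)); ring.
rewrite mulr_sumr (bigID (fun y => lessdot x y)) /=.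
rewrite [X in _ + X = _]big1 ?addr0.
  apply: eq_big => y; last by case/andP => _ ->; rewrite mul1r; ring.
  by rewrite /Defs.lessdot rx; case: eqP; rewrite ?andbF.
by move=> y /andP[_ /negPf->]; rewrite mul0r.
Qed.

Lemma downX1 (x : X) : (rank x < d)%N -> downX [ffun=> 1] x = 1.
Proof.
move=> xd; rewrite ffunE; under eq_bigr do rewrite ffunE mulr1.
by rewrite divff // gt_eqF // pi_up_gt0.
Qed.

(** Jensen: an average squared is at most the average of the squares, pointwise. Integrating,
    adjointness moves [upX] onto the constant 1, which [downX] preserves. *)
Lemma nrm_upX j F : (j < d)%N -> nrm j.+1 (upX F) <= nrm j F.
Proof.
move=> jd; apply: ler_wsqrtr.
pose F2 : fctX := [ffun x => F x ^+ 2].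
apply: (@le_trans _ _ (ip j.+1 (upX F2) [ffun=> 1])).
  apply: ler_sum => y /eqP ry; rewrite !ffunE mulr1 -mulrA ler_wpM2l // ry /=.
  set a : R := (nb j.+1 j)%:R^-1; set c := a * _.
  have c1 : a * (\sum_(x | lessdot x y) 1) <= 1.
    have := @card_lessdot y; rewrite ry /= => /(_ isT) cn.
    rewrite sumr_const /a -cn cardsE.
    set n := #|_|; case: n => [|n]; first by rewrite mulr0.
    by rewrite mulVf ?pnatr_eq0.
  have : 0 <= a * \sum_(x | lessdot x y) (F x - c) ^+ 2.
    by rewrite mulr_ge0 ?invr_ge0 // sumr_ge0 // => x _; rewrite sqr_ge0.
  have -> : \sum_(x | lessdot x y) (F x - c) ^+ 2 =
     \sum_(x | lessdot x y) F2 x - 2 * c * \sum_(x | lessdot x y) F x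
     + c ^+ 2 * \sum_(x | lessdot x y) 1.
    rewrite !mulr_sumr -sumrB -big_split /=; apply: eq_bigr => x _.
    by rewrite ffunE; ring.
  have -> : forall s t u : R, a * (s - 2 * c * t + c ^+ 2 * u) =
     a * s - 2 * c * (a * t) + c ^+ 2 * (a * u) by move=> *; ring.
  rewrite -/c; have := ler_wpM2l (sqr_ge0 c) c1.
  by set u := c ^+ 2 * _; set v := a * _; rewrite mulr1 !expr2; lra.
rewrite ip_upX // le_eqVlt; apply/orP; left; apply/eqP; apply: eq_bigr.
by move=> x /eqP rx; rewrite downX1 ?rx // ffunE; ring.
Qed.

(** By duality with [nrm_upX]: the square of the left side is the inner product of [upX (downX F)]
    with [F]. *)
Lemma nrm_downX j F : (j < d)%N -> nrm j (downX F) <= nrm j.+1 F.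
Proof.
move=> jd; have := nrm_ge0 j (downX F); rewrite le_eqVlt => /orP[/eqP<-|pos].
  exact: nrm_ge0.
rewrite -(ler_pM2l pos) -expr2 sqr_nrm -ip_upX //.
apply: le_trans (ler_norm _) (le_trans (ip_le_nrm _ _ _) _).
by rewrite ler_wpM2r ?nrm_ge0 // nrm_upX.
Qed.

(** The commutation relation at rank 0, where it is exact and [dlt] is 0: an element of rank 1 has a
    single element below it. *)
Lemma downX_upX0 F (x : X) : (0 < d)%N -> rank x = 0%N -> downX (upX F) x = F x.
Proof.
move=> d0 rx; have s0 := pi_up_gt0 (x := x); rewrite rx in s0.
have {s0} s0 := s0 d0.
case: (posetX) => _ /eqP/cards1P[x0 E] _ _.
have uniq (z : X) : rank z = 0%N -> z = x.
  have in0 u : rank u = 0%N -> u = x0.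
    by move=> ru; apply/set1P; rewrite -E inE ru.
  by move=> rz; rewrite (in0 z) // (in0 x).
have lower y : lessdot x y -> [set z | lessdot z y] = [set x].
  move=> xy; apply/setP => z; rewrite !inE; apply/idP/eqP => [|->//].
  case/andP: xy => _; rewrite rx => /eqP ry /andP[_].
  by rewrite ry eqSS eq_sym => /eqP/uniq.
rewrite ffunE -[RHS](mulfK (lt0r_neq0 s0)); congr (_ / _).
rewrite mulr_sumr; apply: eq_bigr => y xy; rewrite mulrC; congr (_ * _).
have y0 : (0 < rank y)%N by case/andP: xy => _ /eqP->.
rewrite ffunE -card_lessdot // (lower y xy) cards1 invr1 mul1r.
rewrite (eq_bigl (mem [set z | lessdot z y])) => [|z]; last by rewrite /= in_set.
by rewrite lower // big_set1.
Qed.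

End Measured.
End LevelOperators.

(** * The approximate commutation relation *)

Section Restriction.
Context (disp : Order.disp_t) (X : finPOrderType disp).
Variables (R : realType) (rank : X -> nat).
Variables (nb : nat -> nat -> nat) (pi : X -> R).

Local Notation fctX := {ffun X -> R^o}.

Lemma sum_level k (P : pred X) (F : X -> R) :
  \sum_(u : level rank k | P (val u)) F (val u) =
  \sum_(x | (rank x == k) && P x) F x.
Proof.
rewrite [RHS](reindex_omap (fun u : level rank k => val u) insub).
  by apply: eq_bigl => u; rewrite valK eqxx andbT (valP u).
by move=> x /andP[xk _]; rewrite insubT.
Qed.

Definition res k (F : fctX) : cochain R rank k := [ffun u => F (val u)].

Let resE k F u : res k F u = F (val u). Proof. exact: ffunE. Qed.

Definition ext k (f : cochain R rank k) : fctX :=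
  [ffun x => if insub x is Some u then f u else 0].

Lemma extK k : cancel (@ext k) (@res k).
Proof. by move=> f; apply/ffunP => u; rewrite !ffunE valK. Qed.

Lemma upop_res i F : upop nb (res i F) = res i.+1 (upX rank nb F).
Proof.
apply/ffunP => y; rewrite !ffunE; have /eqP ry := valP y; rewrite ry /=.
congr (_ * _); rewrite (eq_bigr (fun u => F (val u) : R)) => [|u _]; last exact: resE.
rewrite (sum_level _ (fun x => lessdot rank x (val y))); apply: eq_bigl => x.
by rewrite /lessdot ry eqSS [i == _]eq_sym; case: eqP; rewrite ?andbF.
Qed.

Lemma downop_res i F : downop pi (res i.+1 F) = res i (downX rank pi F).
Proof.
apply/ffunP => x; rewrite !ffunE; have /eqP rx := valP x.
rewrite (eq_bigr (fun y => pi (val y) * F (val y))) => [|y _]; last by rewrite resE.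
rewrite (sum_level _ (fun y => lessdot rank (val x) y) (fun y => pi y * F y)).
rewrite (sum_level _ (fun y => lessdot rank (val x) y)).
have e y : (rank y == i.+1) && lessdot rank (val x) y = lessdot rank (val x) y.
  by rewrite /lessdot rx; case: eqP; rewrite ?andbF.
by congr (_ / _); apply: eq_bigl.
Qed.

Lemma inner_res k F G : inner pi (res k F) (res k G) = ip rank pi k F G.
Proof.
rewrite /inner (eq_bigr (fun u => pi (val u) * F (val u) * G (val u))) => [|u _];
  last by rewrite !resE.
rewrite (sum_level _ xpredT (fun x => pi x * F x * G x)).
by apply: eq_bigl => x; rewrite andbT.
Qed.

Lemma cnorm_res k F : cnorm pi (res k F) = nrm rank pi k F.
Proof. by rewrite /cnorm inner_res. Qed.

Lemma eq_nrm k (F G : fctX) : (forall x, rank x = k -> F x = G x) ->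
  nrm rank pi k F = nrm rank pi k G.
Proof.
move=> FG; congr Num.sqrt; apply: eq_bigr => x /eqP rx.
by rewrite FG.
Qed.

End Restriction.

Section Commutation.
Context (disp : Order.disp_t) (X : finPOrderType disp).
Variables (R : realType) (d : nat) (rank : X -> nat).
Variables (nb : nat -> nat -> nat) (pi : X -> R).
Hypothesis posetX : regular_graded_poset d rank nb.
Hypothesis measX : measured d rank nb pi.

Local Notation fctX := {ffun X -> R^o}.
Local Notation U := (upX rank nb).
Local Notation D := (downX rank pi).
Local Notation nrm := (nrm rank pi).

Let pi_ge0 x : 0 <= pi x. Proof. by case: measX. Qed.

Lemma iter_linearB (f : {linear fctX -> fctX}) n F G :
  iter n f (F - G) = iter n f F - iter n f G.
Proof. by elim: n => //= n ->; rewrite linearB. Qed.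

Lemma nrm_iter_up n j F : (j + n <= d)%N -> nrm (j + n) (iter n U F) <= nrm j F.
Proof.
elim: n => [|n IH] jn /=; first by rewrite addn0.
rewrite addnS in jn *.
exact: le_trans (nrm_upX pi_ge0 posetX measX _ jn) (IH (ltnW jn)).
Qed.

Lemma nrm_iter_down n j F : (j + n <= d)%N -> nrm j (iter n D F) <= nrm (j + n) F.
Proof.
elim: n j => [|n IH] j jn /=; first by rewrite addn0.
apply: le_trans (nrm_downX pi_ge0 posetX measX _ _) _; first by lia.
by rewrite addnS -addSn; apply: IH; lia.
Qed.

Lemma ip_iter_up n j F G : (j + n <= d)%N ->
  ip rank pi (j + n) (iter n U F) G = ip rank pi j F (iter n D G).
Proof.
elim: n j F => [|n IH] j F jn; first by rewrite addn0.
rewrite iterSr addnS -addSn IH; last by rewrite addSn -addnS.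
by rewrite (ip_upX pi_ge0 measX) //; lia.
Qed.

Variables (delta : d.-1.-tuple R) (gamma : R).
Hypothesis eposetX : eposet rank nb pi delta gamma.
Hypothesis gamma_ge0 : 0 <= gamma.

Lemma dlt_itv r : 0 <= dlt delta r <= 1.
Proof.
case: r => [|r] /=; first by rewrite lexx ler01.
case: (ltnP r d.-1) => rd; last first.
  by rewrite nth_default ?size_tuple // lexx ler01.
by case: eposetX => /(_ (Ordinal rd)); rewrite (tnth_nth 0).
Qed.

Lemma dltprod_itv m l : 0 <= dltprod delta m l <= 1.
Proof.
apply/andP; split; first by apply: prodr_ge0 => r _; case/andP: (dlt_itv r).
by apply: prodr_ile1 => r _; apply: dlt_itv.
Qed.

Definition commutator (j : nat) (F : fctX) : fctX :=
  D (U F) - (1 - dlt delta j) *: F - dlt delta j *: U (D F).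

Lemma nrm_commutator j F : (j < d)%N -> nrm j (commutator j F) <= gamma * nrm j F.
Proof.
case: j => [|j] jd.
  rewrite (@eq_nrm _ _ _ _ _ _ _ 0) ?nrm0 // ?mulr_ge0 ?nrm_ge0 //.
  move=> x rx; rewrite !ffunE -[upX _ _ _]/(U F).
  have := downX_upX0 pi_ge0 posetX measX F jd rx; rewrite ffunE => ->.
  by rewrite subr0 scale1r scale0r subrr oppr0 addr0.
have j'd : (j < d)%N by apply: ltnW.
(* This crude bound makes the set in [opnorm] bounded above, so that its [sup] dominates its
   members; it also settles the case of a null [F], which cannot be normalised. *)
have bound G : nrm j.+1 (commutator j.+1 G) <= 3 * nrm j.+1 G.
  have /andP[d0 d1] := dlt_itv j.+1.
  rewrite /commutator.
  have h1 : nrm j.+1 (D (U G)) <= nrm j.+1 G.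
    exact: le_trans (nrm_downX pi_ge0 posetX measX _ jd)
      (nrm_upX pi_ge0 posetX measX _ jd).
  have h2 : nrm j.+1 (U (D G)) <= nrm j.+1 G.
    exact: le_trans (nrm_upX pi_ge0 posetX measX _ j'd)
      (nrm_downX pi_ge0 posetX measX _ j'd).
  apply: (le_trans (nrmD rank pi_ge0 _ _ _)); rewrite nrmN nrmZ ger0_norm //.
  have := nrmD rank pi_ge0 j.+1 (D (U G)) (- ((1 - dlt delta j.+1) *: G)).
  rewrite nrmN nrmZ ger0_norm ?subr_ge0 //.
  have n0 := nrm_ge0 rank pi j.+1 G; have n1 := nrm_ge0 rank pi j.+1 (U (D G)).
  by move: h1 h2 n0 n1 d0 d1; nra.
have [n0|n0] := eqVneq (nrm j.+1 F) 0.
  by have := bound F; rewrite n0 !mulr0.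
have npos : 0 < nrm j.+1 F by rewrite lt_neqAle eq_sym n0 nrm_ge0.
case: eposetX => _ _ /(_ j jd) opb.
pose A := (fun f : cochain R rank j.+1 =>
   [ffun x => downop pi (upop nb f) x - (1 - dlt delta j.+1) * f x
              - dlt delta j.+1 * upop nb (downop pi f) x]) :
   cochain R rank j.+1 -> cochain R rank j.+1.
have A_res G : A (res rank j.+1 G) = res rank j.+1 (commutator j.+1 G).
  rewrite /A upop_res !downop_res upop_res; apply/ffunP => x.
  by rewrite !ffunE.
pose G := (nrm j.+1 F)^-1 *: F.
have nG : nrm j.+1 G = 1.
  by rewrite nrmZ ger0_norm ?invr_ge0 ?nrm_ge0 // mulVf.
have : cnorm pi (A (res rank j.+1 G)) <= opnorm pi A.
  apply: ub_le_sup.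
    exists 3 => _ [f f1 <-]; rewrite -(extK f) A_res cnorm_res.
    apply: le_trans (bound _) _; rewrite -[leRHS]mulr1 ler_wpM2l //.
    by rewrite -cnorm_res extK.
  by exists (res rank j.+1 G) => //=; rewrite cnorm_res nG.
move/le_trans => /(_ _ opb); rewrite A_res cnorm_res.
have -> : commutator j.+1 G = (nrm j.+1 F)^-1 *: commutator j.+1 F.
  rewrite /commutator /G !linearZ /=.
  move: (D (U F)) (U (D F)) => V W.
  by apply/ffunP => x; rewrite !ffunE /GRing.scale /=; ring.
by rewrite nrmZ ger0_norm ?invr_ge0 ?nrm_ge0 // mulrC ler_pdivrMr.
Qed.

Lemma dltprodS m l : (l <= m.+1)%N ->
  dltprod delta m.+1 l = dltprod delta m l * dlt delta m.+1.
Proof. by move=> lm; rewrite /dltprod big_nat_recr. Qed.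

Lemma dltprod_lt m l : (m < l)%N -> dltprod delta m l = 1.
Proof. by move=> ml; rewrite /dltprod big_geq. Qed.

Lemma dltprod0 m : dltprod delta m 0 = 0.
Proof. by rewrite /dltprod big_nat_recl // mul0r. Qed.

(** Induction on [n]: with [p] the weight of passing so far and [e] the next [dlt], the cancelled
    parts add up to [(1 - e) + e * (1 - p) = 1 - p * e]. Since [e <= 1] and [U] is a contraction,
    each step adds at most one commutator error. *)
Lemma down_iter_up n j G : (j + n < d)%N ->
  nrm (j + n) (D (iter n.+1 U G)
     - ((1 - dltprod delta (j + n) j) *: iter n U G
        + dltprod delta (j + n) j *: iter n.+1 U (D G)))
  <= n.+1%:R * gamma * nrm j G.
Proof.
elim: n => [|n IH] jn.
  rewrite addn0 /= {1 2}/dltprod big_nat1 mul1r opprD addrA.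
  by apply: nrm_commutator; rewrite addn0 in jn.
rewrite addnS in jn *; rewrite dltprodS; last by lia.
set p := dltprod _ _ _ in IH *; set e := dlt _ _; set H := iter n.+1 U G.
set E := (X in nrm _ X) in IH.
have -> : D (iter n.+2 U G) - ((1 - p * e) *: H + (p * e) *: iter n.+2 U (D G)) =
   commutator (j + n).+1 H + e *: U E.
  set K := iter n.+2 U (D G).
  have -> : U E = U (D H) - ((1 - p) *: H + p *: K).
    by rewrite /E linearB linearD /= !linearZ.
  rewrite /commutator -[iter n.+2 U G]/(U H) -[dlt _ _]/e.
  move: (D (U H)) (U (D H)) => V W; move: (H) (K) => H' K'.
  by apply/ffunP => x; rewrite !ffunE /GRing.scale /=; ring.
apply: le_trans (nrmD rank pi_ge0 _ _ _) _.
rewrite -natr1 mulrDl mul1r mulrDl addrC; apply: lerD; last first.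
  apply: le_trans (nrm_commutator _ jn) _; rewrite ler_wpM2l // /H -addnS.
  by apply: nrm_iter_up; rewrite addnS ltnW.
have /andP[e0 e1] := dlt_itv (j + n).+1.
rewrite nrmZ ger0_norm //; apply: le_trans (IH (ltnW jn)).
apply: le_trans (ler_piMl (nrm_ge0 _ _ _ _) e1) _.
by apply: (nrm_upX pi_ge0 posetX measX); apply: ltnW.
Qed.

End Commutation.

(** * Pure walks *)

Section WalkLetters.
Variables (d k : nat).

Definition ups j (Y : walk d k j) : nat := count id (letters Y).
Definition downs j (Y : walk d k j) : nat := size (down_positions Y).

Lemma down_positions_rcons s b :
  [seq p <- iota 1 (size (rcons s b)) | ~~ nth true (rcons s b) p.-1] =
  [seq p <- iota 1 (size s) | ~~ nth true s p.-1] ++ nseq (~~ b) (size s).+1.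
Proof.
rewrite size_rcons -[X in iota _ X](addn1 (size s)) iotaD filter_cat add1n.
congr (_ ++ _).
  apply: eq_in_filter => p; rewrite mem_iota nth_rcons => /andP[p1 ps].
  by rewrite ifT //; lia.
by rewrite /= nth_rcons ltnn eqxx; case: b.
Qed.

Lemma down_positions_Up j (Y : walk d k j) jd :
  down_positions (Up Y jd) = down_positions Y.
Proof. by rewrite /down_positions /= down_positions_rcons cats0. Qed.

Lemma down_positions_Down j (Y : walk d k j.+1) :
  down_positions (Down Y) = rcons (down_positions Y) (size (letters Y)).+1.
Proof. by rewrite /down_positions /= down_positions_rcons cats1. Qed.

Lemma walk_balance j (Y : walk d k j) :
  (j + downs Y = k + ups Y)%N /\ size (letters Y) = (downs Y + ups Y)%N.
Proof.
rewrite /ups /downs; elim: Y => [|{}j Y [IH1 IH2] jd|{}j Y [IH1 IH2]] //=.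
- by rewrite down_positions_Up size_rcons -cats1 count_cat /=; lia.
- by rewrite down_positions_Down !size_rcons -cats1 count_cat /=; lia.
Qed.

Lemma walk_le j (Y : walk d k j) : (k <= d)%N -> (j <= d)%N.
Proof. by move=> kd; elim: Y => // {}j Y /ltnW. Qed.

Lemma letters_nil (Y : walk d k k) : height Y = 0%N -> letters Y = [::].
Proof.
move=> h0; apply: size0nil; have [] := walk_balance Y; rewrite /downs.
by move: h0; rewrite /height => ->; lia.
Qed.

Variables (R : realType) (delta : d.-1.-tuple R).

(** [walk_eigenvalue] for walks ending at any rank, because the prefixes met in an induction on a
    closed walk need not be closed. *)
Definition walk_eig j (Y : walk d k j) (l : nat) : R :=
  \prod_(s < size (down_positions Y))
    (1 - dltprod delta (k + nth 0%N (down_positions Y) s - 2 * s.+1) l).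

Lemma walk_eig_Up j (Y : walk d k j) jd l : walk_eig (Up Y jd) l = walk_eig Y l.
Proof. by rewrite /walk_eig down_positions_Up. Qed.

(** The [s]-th down operator, at position [i_s], follows [i_s - s] up operators and so reaches rank
    [k + (i_s - s) - s], which is the [j] here. *)
Lemma walk_eig_Down j (Y : walk d k j.+1) l :
  walk_eig (Down Y) l = walk_eig Y l * (1 - dltprod delta j l).
Proof.
rewrite /walk_eig down_positions_Down size_rcons big_ord_recr /=.
rewrite nth_rcons ltnn eqxx.
have -> : (k + (size (letters Y)).+1 - 2 * (size (down_positions Y)).+1 = j)%N.
  by have [] := walk_balance Y; rewrite /downs; lia.
congr (_ * _); by apply: eq_bigr => s _; rewrite nth_rcons ltn_ord.
Qed.

End WalkLetters.

(** * Leading weight and error along a walk *)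

Section Hull.
Context (disp : Order.disp_t) (X : finPOrderType disp).
Variables (R : realType) (d : nat) (rank : X -> nat).
Variables (nb : nat -> nat -> nat) (pi : X -> R).
Variables (delta : d.-1.-tuple R) (gamma : R).
Hypothesis posetX : regular_graded_poset d rank nb.
Hypothesis measX : measured d rank nb pi.
Hypothesis eposetX : eposet rank nb pi delta gamma.
Hypothesis gamma_ge0 : 0 <= gamma.

Local Notation fctX := {ffun X -> R^o}.
Local Notation U := (upX rank nb).
Local Notation D := (downX rank pi).
Local Notation nrm := (nrm rank pi).
Local Notation ip := (ip rank pi).

Let pi_ge0 x : 0 <= pi x. Proof. by case: measX. Qed.

Fixpoint walkX k j (Y : walk d k j) : fctX -> fctX :=
  match Y with
  | Stay => fun F => F
  | Up _ Y' _ => fun F => U (walkX Y' F)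
  | Down _ Y' => fun F => D (walkX Y' F)
  end.

Lemma walk_op_res k j (Y : walk d k j) F :
  walk_op nb pi Y (res rank k F) = res rank j (walkX Y F).
Proof.
by elim: Y => //= {}j Y => [IH jd|IH]; rewrite IH ?upop_res ?downop_res.
Qed.

Lemma walkX_nil k j (Y : walk d k j) F : letters Y = [::] -> walkX Y F = F.
Proof. by case: Y => //= {}j Y; case: (letters Y). Qed.

Variables (i : nat) (g : fctX).
Hypothesis i_gt0 : (0 < i)%N.
Hypothesis i_le_d : (i <= d)%N.

(* Convex combinations at level [j] of [U^n g], carrying total weight [a], and
   of the vectors [U^n D^l g] with [l > 0]. *)
Inductive hull (j : nat) : R -> fctX -> Prop :=
| hull_lead n : j = (i + n)%N -> hull j 1 (iter n U g)
| hull_rest n l : (l < i)%N -> j = (i - l.+1 + n)%N ->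
    hull j 0 (iter n U (iter l.+1 D g))
| hull_conv t a b F G : 0 <= t <= 1 -> hull j a F -> hull j b G ->
    hull j (t * a + (1 - t) * b) (t *: F + (1 - t) *: G).

Lemma hull_up j a F : hull j a F -> hull j.+1 a (U F).
Proof.
elim=> {a F} [n ->|n l li ->|t a b F G t01 _ hF _ hG].
- by rewrite -iterS; apply: hull_lead; rewrite addnS.
- by rewrite -iterS; apply: hull_rest => //; rewrite addnS.
- by rewrite linearD /= !linearZ; apply: hull_conv.
Qed.

Let hull_step j n l : (l < i)%N -> j = (i - l + n)%N -> (j < d)%N ->
  let p := dltprod delta (i - l + n) (i - l) in
  let G := (1 - p) *: iter n U (iter l D g) + p *: iter n.+1 U (iter l.+1 D g) in
  nrm j (D (iter n.+1 U (iter l D g)) - G) <= j.+1%:R * gamma * nrm i g.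
Proof.
move=> li -> jd; cbv zeta.
apply: le_trans (down_iter_up posetX measX eposetX gamma_ge0 _ jd) _.
rewrite -!mulrA ler_pM ?mulr_ge0 ?nrm_ge0 // ?ler_nat ?ltnS ?leq_addl //.
rewrite ler_wpM2l //.
apply: le_trans (nrm_iter_down posetX measX _ _) _; first by lia.
by rewrite subnK // ltnW.
Qed.

(** A leading vector splits into a leading one and a remainder, while remainders produce only
    remainders; so the weight is multiplied by a factor depending on [j] alone. All generators obey
    the same error bound, which a convex combination preserves. *)
Lemma hull_down j a F : (j < d)%N -> hull j.+1 a F ->
  exists2 G, hull j (a * (1 - dltprod delta j i)) G
    & nrm j (D F - G) <= j.+1%:R * gamma * nrm i g.
Proof.
move=> jd; have pos : 0 <= j.+1%:R * gamma * nrm i g.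
  by rewrite !mulr_ge0 ?nrm_ge0.
have conv (p : R) A B : 0 <= p <= 1 -> forall a b c : R, hull j a A -> hull j b B ->
    c = (1 - p) * a + p * b -> hull j c ((1 - p) *: A + p *: B).
  move=> p01 a' b' c hA hB ->; rewrite -{2 4}[p](subKr 1).
  by apply: hull_conv => //; case/andP: p01; lra.
elim=> {a F} [[|n]|[|n] l li|t a b F G t01 _ [F' hF eF] _ [G' hG eG]].
- rewrite addn0 => ji; exists (D g); last by rewrite subrr nrm0.
  (* No up operator is left to cancel: the product is empty, hence 1, and the leading weight drops
     to 0. *)
  rewrite dltprod_lt ?ji // subrr mulr0.
  by apply: (@hull_rest _ 0%N 0%N) => //; lia.
- rewrite addnS => -[jn].
  have := @hull_step j n 0%N i_gt0; rewrite subn0 => /(_ jn jd) e.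
  eexists; last exact: e.
  apply: (conv _ _ _ (dltprod_itv eposetX _ _) 1 0).
  + exact: hull_lead.
  + by apply: (@hull_rest _ n.+1 0%N) => //; lia.
  + by rewrite jn; ring.
- rewrite addn0 mul0r => jl; exists (iter l.+2 D g).
    by apply: (@hull_rest _ 0%N l.+1) => //; lia.
  by rewrite subrr nrm0.
- rewrite addnS mul0r => -[jn].
  have rest : hull j 0 (iter n U (iter l.+1 D g)) by apply: hull_rest.
  have [li'|il] := ltnP l.+1 i.
    have e := @hull_step j n l.+1 li' jn jd.
    eexists; last exact: e.
    apply: (conv _ _ _ (dltprod_itv eposetX _ _) 0 0) => //.
    + by apply: (@hull_rest _ n.+1 l.+1) => //; lia.
    + by rewrite !mulr0 addr0.
  exists (iter n U (iter l.+1 D g)) => //.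
  (* The down operators have brought [g] to rank 0 and cannot pass further; accordingly the product
     contains [dlt delta 0 = 0] and only the cancellation remains. *)
  have il0 : (i - l.+1 = 0)%N by lia.
  have jd' : (i - l.+1 + n < d)%N by rewrite -jn.
  have := down_iter_up posetX measX eposetX gamma_ge0 (iter l.+1 D g) jd'.
  have -> : dltprod delta (i - l.+1 + n) (i - l.+1) = 0 by rewrite il0 dltprod0.
  rewrite -jn subr0 scale1r scale0r addr0.
  move=> /le_trans; apply; rewrite -!mulrA ler_pM ?mulr_ge0 ?nrm_ge0 //.
    by rewrite ler_nat; lia.
  rewrite ler_wpM2l //.
  apply: le_trans (nrm_iter_down posetX measX _ _) _; first by lia.
  by rewrite subnK.
- exists (t *: F' + (1 - t) *: G').
    by rewrite mulrDl -!mulrA; apply: hull_conv.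
  have -> : D (t *: F + (1 - t) *: G) - (t *: F' + (1 - t) *: G') =
     t *: (D F - F') + (1 - t) *: (D G - G').
    rewrite linearD /= !linearZ /=; move: (D F) (D G) => V W.
    by apply/ffunP => x; rewrite !ffunE /GRing.scale /=; ring.
  apply: le_trans (nrmD rank pi_ge0 _ _ _) _; rewrite !nrmZ.
  case/andP: t01 => t0 t1; rewrite !ger0_norm ?subr_ge0 //.
  move: eF eG; set e := _ * nrm i g => eF eG.
  have -> : e = t * e + (1 - t) * e by ring.
  by rewrite lerD // ler_wpM2l // subr_ge0.
Qed.

Lemma hull_ip a F : hull i a F ->
  `|ip i F g - a * nrm i g ^+ 2| <= nrm i.-1 (D g) ^+ 2.
Proof.
have sq0 : 0 <= nrm i.-1 (D g) ^+ 2 by rewrite sqr_ge0.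
elim=> {a F} [n|n l li|t a b F G /andP[t0 t1] _ hF _ hG].
- case: n => [_|n ?]; last by lia.
  by rewrite /= mul1r sqr_nrm // subrr normr0.
- move=> e; have en : n = l.+1 by lia.
  rewrite mul0r subr0 {}en in e *; rewrite {1}e.
  rewrite (ip_iter_up measX) -?e //.
  rewrite -sqr_nrm // ger0_norm ?sqr_ge0 // ler_pXn2r ?nnegrE ?nrm_ge0 // iterSr.
  apply: le_trans (nrm_iter_down posetX measX _ _) _; first by lia.
  by have -> : (i - l.+1 + l = i.-1)%N by lia.
- have -> : ip i (t *: F + (1 - t) *: G) g - (t * a + (1 - t) * b) * nrm i g ^+ 2
    = t * (ip i F g - a * nrm i g ^+ 2)
      + (1 - t) * (ip i G g - b * nrm i g ^+ 2).
    by rewrite ipDl !ipZl; ring.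
  apply: le_trans (ler_normD _ _) _; rewrite !normrM.
  rewrite !(@ger0_norm _ t) ?(@ger0_norm _ (1 - t)) ?subr_ge0 //.
  set e := leRHS; have -> : e = t * e + (1 - t) * e by ring.
  by rewrite lerD // ler_wpM2l // subr_ge0.
Qed.

(** Up operators cost nothing, being contractions that preserve the hull. A down operator reaching
    rank [j] costs [j.+1] units, and [j.+1] is at most [k] plus the number of up operators. *)
Lemma walk_hull k j (Y : walk d k j) a F : (k <= d)%N -> hull k a F ->
  exists2 G, hull j (a * walk_eig delta Y i) G &
    nrm j (walkX Y F - G) <= (downs Y * (k + ups Y))%:R * gamma * nrm i g.
Proof.
move=> kd hF; elim: Y => [|{}j Y [G hG eG] jd|{}j Y [G hG eG]] /=.
- exists F; first by rewrite /walk_eig big_ord0 mulr1.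
  by rewrite subrr nrm0 !mulr_ge0 ?nrm_ge0.
- exists (U G); first by rewrite walk_eig_Up; apply: hull_up.
  rewrite -linearB; apply: le_trans (nrm_upX pi_ge0 posetX measX _ jd) _.
  apply: le_trans eG _.
  rewrite -!mulrA ler_wpM2r ?mulr_ge0 ?nrm_ge0 // ler_nat.
  by rewrite /downs down_positions_Up leq_mul // /ups /= -cats1 count_cat /=; lia.
- have jd := walk_le Y kd; have [G' hG' eG'] := hull_down jd hG.
  exists G'; first by rewrite walk_eig_Down mulrA.
  have -> : D (walkX Y F) - G' = D (walkX Y F - G) + (D G - G').
    by rewrite linearB addrA subrK.
  apply: le_trans (nrmD rank pi_ge0 _ _ _) _.
  apply: (@le_trans _ _ ((downs Y * (k + ups Y) + j.+1)%:R * gamma * nrm i g)).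
    rewrite natrD 2!mulrDl lerD //.
    exact: le_trans (nrm_downX pi_ge0 posetX measX _ jd) eG.
  rewrite -!mulrA ler_wpM2r ?mulr_ge0 ?nrm_ge0 // ler_nat.
  have [] := walk_balance Y; rewrite /downs down_positions_Down size_rcons.
  by rewrite /ups /= -cats1 count_cat /=; nia.
Qed.

(** The factor contributed by the closing [D^n], the same for all walks on rank [i + n]. *)
Let q n : R := \prod_(m < n) (1 - dltprod delta (i + m) i).

Lemma iter_down_hull n a F : (i + n <= d)%N -> hull (i + n) a F ->
  exists2 G, hull i (a * q n) G &
    nrm i (iter n D F - G) <= (n * (i + n))%:R * gamma * nrm i g.
Proof.
rewrite /q; elim: n a F => [|n IH] a F nd hF.
  exists F; first by rewrite big_ord0 mulr1 -[i]addn0.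
  by rewrite subrr nrm0 mul0n !mul0r.
rewrite addnS in nd hF *; have [G hG eG] := hull_down nd hF.
have [G' hG' eG'] := IH _ _ (ltnW nd) hG.
exists G'; first by rewrite big_ord_recr /= [X in a * X]mulrC mulrA.
have -> : iter n.+1 D F - G' = iter n D (D F - G) + (iter n D G - G').
  by rewrite iterSr iter_linearB addrA subrK.
apply: le_trans (nrmD rank pi_ge0 _ _ _) _.
apply: (@le_trans _ _ (((i + n).+1 + n * (i + n))%:R * gamma * nrm i g)).
  rewrite natrD 2!mulrDl lerD //.
  exact: le_trans (nrm_iter_down posetX measX _ (ltnW nd)) eG.
by rewrite -!mulrA ler_wpM2r ?mulr_ge0 ?nrm_ge0 // ler_nat; nia.
Qed.

Hypothesis lazy_g : nrm i.-1 (D g) ^+ 2 <= gamma * nrm i g ^+ 2.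

(** Adjointness moves the [U^n] of the second [f] to a [D^n] after the walk. The three summands of
    the error come from the walk, from this [D^n], and from non-laziness. *)
Lemma walk_quad n (Y : walk d (i + n) (i + n)) : (i + n <= d)%N ->
  let f := iter n U g in
  `|ip (i + n) (walkX Y f) f - walk_eig delta Y i * q n * nrm i g ^+ 2| <=
  (downs Y * (i + n + ups Y) + n * (i + n) + 1)%:R * gamma * nrm i g ^+ 2.
Proof.
move=> nd; cbv zeta; set f := iter n U g.
have hf : hull (i + n) 1 f by apply: hull_lead.
have [G hG eG] := walk_hull Y nd hf; rewrite mul1r in hG.
have [G' hG' eG'] := iter_down_hull nd hG.
have eI := le_trans (hull_ip hG') lazy_g.
rewrite (ipC _ _ _ (walkX Y f)) (ip_iter_up measX) // ipC.
set W := iter n D (walkX Y f).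
have eW : nrm i (W - G') <=
    (downs Y * (i + n + ups Y) + n * (i + n))%:R * gamma * nrm i g.
  have -> : W - G' = iter n D (walkX Y f - G) + (iter n D G - G').
    by rewrite iter_linearB addrA subrK.
  apply: le_trans (nrmD rank pi_ge0 _ _ _) _; rewrite natrD 2!mulrDl lerD //.
  exact: le_trans (nrm_iter_down posetX measX _ nd) eG.
have -> : ip i W g - walk_eig delta Y i * q n * nrm i g ^+ 2 =
   ip i (W - G') g + (ip i G' g - walk_eig delta Y i * q n * nrm i g ^+ 2).
  by rewrite ipBl; ring.
apply: le_trans (ler_normD _ _) _; rewrite natrD 2!mulrDl mul1r lerD //.
apply: le_trans (ip_le_nrm rank pi_ge0 _ _ _) _.
by rewrite expr2 mulrA ler_wpM2r ?nrm_ge0.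
Qed.

Lemma walk_eig_itv k j (Y : walk d k j) l : 0 <= walk_eig delta Y l <= 1.
Proof.
have h (s : 'I_(size (down_positions Y))) :
  0 <= 1 - dltprod delta (k + nth 0%N (down_positions Y) s - 2 * s.+1) l <= 1.
  have /andP[] := dltprod_itv eposetX
    (k + nth 0%N (down_positions Y) s - 2 * s.+1) l.
  by lra.
apply/andP; split; first by apply: prodr_ge0 => s _; case/andP: (h s).
by apply: prodr_ile1 => s _; apply: h.
Qed.

Lemma walk_rayleigh n (Y : walk d (i + n) (i + n)) : (i + n <= d)%N ->
  let f := iter n U g in
  `|ip (i + n) (walkX Y f) f - walk_eigenvalue delta Y i * ip (i + n) f f| <=
  (5 * ((i + n) * height Y * (height Y + (i + n))))%:R * gamma * nrm i g ^+ 2.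
Proof.
move=> nd; cbv zeta; set f := iter n U g.
rewrite -[walk_eigenvalue _ _ _]/(walk_eig delta Y i).
(* At height 0 the claimed error vanishes, so the estimate must be exact: the walk is empty. *)
have [h0|h_gt0] := posnP (height Y).
  rewrite (walkX_nil _ (letters_nil h0)).
  rewrite h0 /walk_eig -/(height Y) h0 big_ord0 mul1r subrr normr0.
  by rewrite !mulr_ge0 ?nrm_ge0.
have := walk_quad Y nd; have := walk_quad (Stay d (i + n)) nd => /=.
rewrite -/f -[downs (Stay _ _)]/0%N mul0n add0n {1}/walk_eig big_ord0 mul1r.
have /andP[e0 e1] := walk_eig_itv Y i; set e := walk_eig _ _ _ in e0 e1 *.
set s := q n * _; rewrite -!(mulrA _ _ (nrm i g ^+ 2)) -/s => h1 h2.
have -> : ip (i + n) (walkX Y f) f - e * ip (i + n) f f =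
  (ip (i + n) (walkX Y f) f - e * s) - e * (ip (i + n) f f - s) by ring.
apply: le_trans (ler_normB _ _) _; rewrite normrM (ger0_norm e0).
have h3 : e * `|ip (i + n) f f - s| <= `|ip (i + n) f f - s|.
  by rewrite ler_piMl.
apply: le_trans (lerD h2 (le_trans h3 h1)) _.
(* With [k = i + n] and [h] the height, the errors for [Y] and for the empty walk total
   [h * (k + h) + 2 * n * k + 2]. Each of [h * (k + h)], [n * k] and 1 is at most [k * h * (h + k)],
   whence the constant 5. *)
rewrite -mulrDl -natrD ler_wpM2r ?mulr_ge0 ?nrm_ge0 // ler_nat.
have [eq1 _] := walk_balance Y; rewrite -[downs Y]/(height Y) in eq1 *.
have -> : ups Y = height Y by lia.
have : (0 < i + n)%N by lia.
have : (n <= i + n)%N by lia.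
move: (i + n)%N (height Y) h_gt0 => k h h0 nk k0.
have : (n * k <= k * k)%N by rewrite leq_mul2r nk orbT.
have : (k * k <= k * h * k)%N by rewrite leq_mul // leq_pmulr.
have : (0 < k * h * (h + k))%N by rewrite !muln_gt0 h0 k0 addn_gt0 h0.
have : (h * (k + h) <= k * (h * (k + h)))%N by rewrite leq_pmull.
have -> : (k * h * (h + k) = k * h * h + k * h * k)%N by rewrite mulnDr.
have -> : (k * (h * (k + h)) = k * h * h + k * h * k)%N.
  by rewrite mulnA mulnDr addnC.
have : (k <= k * h * k)%N by rewrite -{1}[k]mul1n leq_mul // muln_gt0 k0.
by move: (k * h * h)%N (k * h * k)%N (h * (k + h))%N (n * k)%N (k * k)%N; lia.
Qed.

End Hull.

(** * Links and their edge expansion *)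

Definition indicX (R : realType) (X : finType) (t : X) : {ffun X -> R^o} :=
  [ffun x => (x == t)%:R].

Section Links.
Context (disp : Order.disp_t) (X : finPOrderType disp).
Variables (R : realType) (d : nat) (rank : X -> nat).
Variables (nb : nat -> nat -> nat) (pi : X -> R).
Hypothesis posetX : regular_graded_poset d rank nb.
Hypothesis measX : measured d rank nb pi.

Local Notation fctX := {ffun X -> R^o}.
Local Notation U := (upX rank nb).
Local Notation D := (downX rank pi).
Local Notation nrm := (nrm rank pi).
Local Notation ip := (ip rank pi).

Let pi_ge0 x : 0 <= pi x. Proof. by case: measX. Qed.

Lemma exists_above n (t : X) : (rank t + n <= d)%N ->
  exists2 y, (t <= y)%O & rank y = (rank t + n)%N.
Proof.
elim: n => [|n IH]; first by exists t; rewrite ?lexx ?addn0.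
rewrite addnS => td; have [y ty ry] := IH (ltnW td); rewrite -ry in td *.
have [z yz|none] := pickP (fun z => lessdot rank y z).
  by case/andP: yz => yz /eqP rz; exists z; rewrite // (le_trans ty (ltW yz)).
by have := pi_up_gt0 pi_ge0 measX td; rewrite big_pred0 // ltxx.
Qed.

Lemma Rmax_gt0 k : (0 < k <= d)%N -> (0 < Rmax nb k)%N.
Proof.
case/andP; case: k => // k _ kd.
have /cards1P[x0 E] : #|[set x | rank x == 0%N]| == 1%N.
  by case: posetX => _ -> _ _.
have r0 : rank x0 = 0%N.
  by have := set11 x0; rewrite -E inE => /eqP.
have [|x _ rx] := @exists_above k x0; first by rewrite r0 ltnW.
rewrite r0 add0n in rx.
have nz : (0 < nb k.+1 k)%N.
  (* Were the number of lower covers 0, its inverse would be 0 as well, and the induced [pi x] would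
     vanish. *)
  rewrite lt0n; apply/eqP => n0; case: measX => _ pos _ /(_ x).
  rewrite rx n0 invr0 mul0r => /(_ kd) e.
  by have := pos x; rewrite e rx kd ltxx => /(_ isT).
apply: leq_trans nz _.
exact: (@leq_bigmax_cond _ xpredT (fun j : 'I_k.+2 => nb k.+1 j)
  (widen_ord (leqnSn k.+1) ord_max)).
Qed.

Lemma nbe_le k i : (i <= k)%N -> (0 < k <= d)%N -> (nbe nb k i <= Rmax nb k)%N.
Proof.
move=> ik kd; rewrite /nbe; case: eqP => _; first exact: Rmax_gt0.
have ik' : (i < k.+1)%N by [].
exact: (@leq_bigmax_cond _ xpredT (fun j : 'I_k.+1 => nb k j) (Ordinal ik')).
Qed.

Lemma iter_down1 n x : (rank x + n <= d)%N -> iter n D [ffun=> 1] x = 1.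
Proof.
elim: n x => [|n IH] x xd /=; first by rewrite ffunE.
have xd' : (rank x < d)%N by apply: leq_trans xd; rewrite addnS ltnS leq_addr.
rewrite -[RHS](downX1 pi_ge0 measX xd') !ffunE; congr (_ / _).
apply: eq_bigr => y /andP[_ /eqP ry].
by rewrite ffunE IH // ry addSn -addnS.
Qed.

Variable t : X.

Lemma ip_point F : ip (rank t) F (indicX R t) = pi t * F t.
Proof.
rewrite -[LHS]/(\sum_(x | rank x == rank t) pi x * F x * indicX R t x).
rewrite (bigD1 t) //= big1 ?addr0; first by rewrite ffunE eqxx mulr1.
by move=> x /andP[_ /negPf xt]; rewrite ffunE xt mulr0.
Qed.

Lemma sqr_nrm_point : nrm (rank t) (indicX R t) ^+ 2 = pi t.
Proof. by rewrite sqr_nrm // ip_point ffunE eqxx mulr1. Qed.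

(** By induction, one more [U] multiplies the value by the proportion of lower covers of [x] above
    [t], which [covers_mul] computes. *)
Lemma iter_up_point n x : rank x = (rank t + n)%N ->
  iter n U (indicX R t) x = (t <= x)%O%:R / (nbe nb (rank t + n) (rank t))%:R.
Proof.
elim: n x => [|n IH] x rx /=.
  rewrite addn0 in rx *; rewrite ffunE /nbe eqxx divr1; congr (_ %:R).
  congr nat_of_bool; apply/eqP/idP => [->|tx]; first exact: lexx.
  by symmetry; apply: (le_rank_eq posetX tx).
rewrite ffunE rx addnS /=.
under eq_bigr => y /andP[_ /eqP ry].
  rewrite IH; last by move: ry; rewrite rx addnS => -[].
  over.
rewrite /= -mulr_suml -natr_sum.
case: (boolP (t <= x)%O) => tx; last first.
  rewrite big1 ?mul0r ?mulr0 // => y /andP[yx _].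
  apply/eqP; rewrite eqb0; apply: contra tx => ty.
  exact: le_trans ty (ltW yx).
have {}tx : (t < x)%O.
  rewrite lt_neqAle tx andbT; apply/eqP => e; move: rx; rewrite -e; lia.
have := covers_mul posetX tx (_ : rank x = (rank t + n).+1).
rewrite rx addnS => /(_ erefl); have := card_covers_gt0 posetX tx.
rewrite -sum1dep_card big_mkcondr /=.
have -> : (\sum_(y | lessdot rank y x) (if (t <= y)%O then 1 else 0) =
   \sum_(y | lessdot rank y x) (t <= y)%O)%N.
  by apply: eq_bigr => y _; case: (_ <= _)%O.
set s := bigop _ _ _ => s0 e.
have N0 : (0 < nbe nb (rank t + n).+1 (rank t))%N.
  by rewrite -addnS -rx; apply: (nbe_gt0 posetX); apply: ltW.
have : (0 < nb (rank t + n).+1 (rank t + n) * nbe nb (rank t + n) (rank t))%N.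
  by rewrite -e muln_gt0 s0.
rewrite muln_gt0 => /andP[a0 b0].
move/(congr1 (fun m => m%:R : R)): e; rewrite !natrM.
have : (nbe nb (rank t + n).+1 (rank t))%:R != 0 :> R by rewrite pnatr_eq0 -lt0n.
have : (nb (rank t + n).+1 (rank t + n))%:R != 0 :> R by rewrite pnatr_eq0 -lt0n.
have : (nbe nb (rank t + n) (rank t))%:R != 0 :> R by rewrite pnatr_eq0 -lt0n.
move: (nbe nb _ _)%:R (nb _ _)%:R (nbe nb _ _)%:R s%:R => A B C S A0 B0 C0 e.
rewrite -[S](mulfK C0) e /=; field.
by rewrite A0 B0 C0.
Qed.

(** Let [f] be the iterate. Being an indicator divided by a number [N], it satisfies [f^2 = f / N];
    so its squared norm is its integral divided by [N], and the integral is [pi t] because [D]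
    preserves the constant 1. *)
Lemma ip_iter_up_point n : (rank t + n <= d)%N ->
  ip (rank t + n) (iter n U (indicX R t)) (iter n U (indicX R t)) =
  pi t / (nbe nb (rank t + n) (rank t))%:R.
Proof.
move=> nd.
transitivity (ip (rank t + n) (iter n U (indicX R t)) [ffun=> 1] /
  (nbe nb (rank t + n) (rank t))%:R).
  rewrite mulr_suml; apply: eq_bigr => x /eqP rx.
  by rewrite ffunE iter_up_point //; case: (t <= x)%O => /=; ring.
rewrite (ip_iter_up measX) // ipC ip_point iter_down1 ?mulr1 //.
Qed.

End Links.

(** * Edge expansion as a Rayleigh quotient *)

Section Expansion.
Context (disp : Order.disp_t) (X : finPOrderType disp).
Variables (R : realType) (d : nat) (rank : X -> nat).
Variables (nb : nat -> nat -> nat) (pi : X -> R).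

Local Notation fctX := {ffun X -> R^o}.
Local Notation ip := (ip rank pi).

Lemma walkX_is_linear k j (Y : walk d k j) : linear (walkX rank nb pi Y).
Proof. by move=> a F G; elim: Y => //= {}j Y => [IH jd|IH]; rewrite IH linearP. Qed.
HB.instance Definition _ k j (Y : walk d k j) :=
  GRing.isLinear.Build R fctX fctX *:%R (walkX rank nb pi Y) (walkX_is_linear Y).

Definition affineX k (M : affine_walk R d k) (F : fctX) : fctX :=
  \sum_(j < aw_size M) aw_coef j *: walkX rank nb pi (aw_walk j) F.

Lemma affineX_is_linear k (M : affine_walk R d k) : linear (affineX M).
Proof.
move=> a F G; rewrite /affineX scaler_sumr -big_split /=; apply: eq_bigr => j _.
by rewrite linearP scalerDr !scalerA mulrC.
Qed.
HB.instance Definition _ k (M : affine_walk R d k) :=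
  GRing.isLinear.Build R fctX fctX *:%R (affineX M) (affineX_is_linear M).

Lemma aw_op_res k (M : affine_walk R d k) F :
  aw_op nb pi M (res rank k F) = res rank k (affineX M F).
Proof.
apply/ffunP => v; rewrite !ffunE /affineX sum_ffunE; apply: eq_bigr => j _.
by rewrite walk_op_res !ffunE.
Qed.

Lemma ip_affineX k (M : affine_walk R d k) F G :
  ip k (affineX M F) G =
  \sum_(j < aw_size M) aw_coef j * ip k (walkX rank nb pi (aw_walk j) F) G.
Proof.
rewrite /affineX; elim/big_rec2: _ => [|j s F' _ <-].
  by rewrite -(scale0r 0) ipZl mul0r.
by rewrite ipDl ipZl.
Qed.

(** As rows sum to 1, the probability of leaving is 1 minus that of staying, and the latter is the
    walk applied to the indicator [E]. *)
Lemma expansionE k (M : affine_walk R d k) i (tau : level rank i) (E : fctX) :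
  stochastic (aw_op (rank := rank) nb pi M) -> 0 < ip k E E ->
  (forall x, rank x = k -> E x = (val tau <= x)%O%:R) ->
  expansion pi (aw_op nb pi M) (above k tau) =
    1 - ip k (affineX M E) E / ip k E E.
Proof.
move=> [_ st] E0 hE; pose S := above k tau.
have inS v : (v \in S) = (val tau <= val v)%O by rewrite inE.
have resE : res rank k E = \sum_(y in S) indic R y.
  apply/ffunP => v; rewrite sum_ffunE ffunE hE; last by apply/eqP; exact: (valP v).
  rewrite -inS; under eq_bigr do rewrite ffunE.
  case: (boolP (v \in S)) => vS.
    rewrite (bigD1 v) //= eqxx big1 ?addr0 // => y /andP[_ /negPf yv].
    by rewrite eq_sym yv.
  by rewrite big1 // => y yS; case: eqP => // e; rewrite e yS in vS.
have row v : \sum_(y in ~: S) transition (aw_op (rank := rank) nb pi M) v y =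
    1 - affineX M E (val v).
  rewrite -(st v).
  have -> : affineX M E (val v) =
      \sum_(y in S) transition (aw_op (rank := rank) nb pi M) v y.
    transitivity (aw_op nb pi M (res rank k E) v).
      by rewrite aw_op_res ffunE.
    (* Representing each [indic] by a function on [X] makes the linearity of [affineX] available. *)
    have indicE y : indic R y = res rank k (ext (indic R y)) by rewrite extK.
    have -> : res rank k E = res rank k (\sum_(y in S) ext (indic R y)).
      rewrite resE; apply/ffunP => u; rewrite !ffunE !sum_ffunE.
      by apply: eq_bigr => y _; rewrite [in LHS]indicE ffunE.
    rewrite aw_op_res ffunE linear_sum /= sum_ffunE; apply: eq_bigr => y _.
    by rewrite /transition [in RHS]indicE aw_op_res ffunE.
  rewrite [X in _ = X - _](bigID (mem S)) /= [RHS]addrC addKr.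
  by apply: eq_bigl => y; rewrite in_setC.
have sumS (F : X -> R) : \sum_(v in S) pi (val v) * F (val v) =
    \sum_(x | rank x == k) pi x * F x * E x.
  rewrite (eq_bigl (fun v : level rank k => (val tau <= val v)%O)) //.
  rewrite (sum_level _ _ (fun x => (val tau <= x)%O) (fun x => pi x * F x)).
  rewrite big_mkcondr; apply: eq_bigr => x /eqP rx.
  by rewrite hE //; case: (_ <= _)%O; rewrite ?mulr1 ?mulr0.
have den : \sum_(v in S) pi (val v) = ip k E E.
  have := sumS (fun=> 1).
  rewrite (eq_bigr (fun v => pi (val v))) => [->|v _]; last by rewrite mulr1.
  apply: eq_bigr => x /eqP rx; rewrite hE // mulr1.
  by case: (_ <= _)%O; rewrite ?mulr1 ?mulr0.
rewrite /expansion -/S; under eq_bigr do rewrite row mulrBr mulr1.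
rewrite sumrB den (sumS (affineX M E)) -[bigop _ _ _]/(ip k (affineX M E) E).
by rewrite mulrBl divff // gt_eqF.
Qed.

End Expansion.

(** * The bound for links *)

Section Bound.
Context (disp : Order.disp_t) (X : finPOrderType disp).
Variables (R : realType) (d : nat) (rank : X -> nat).
Variables (nb : nat -> nat -> nat) (pi : X -> R).
Variables (delta : d.-1.-tuple R) (gamma : R).
Hypothesis posetX : regular_graded_poset d rank nb.
Hypothesis measX : measured d rank nb pi.
Hypothesis eposetX : eposet rank nb pi delta gamma.
Hypothesis lazyX : non_lazy d rank nb pi gamma.

Local Notation U := (upX rank nb).
Local Notation D := (downX rank pi).
Local Notation nrm := (nrm rank pi).
Local Notation ip := (ip rank pi).

Let pi_ge0 x : 0 <= pi x. Proof. by case: measX. Qed.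

(** By adjointness the left side is [pi t] times the value of [U D g] at [t], that is, the return
    probability of the lower walk. *)
Lemma non_lazy_point (t : X) : (0 < rank t <= d)%N ->
  nrm (rank t).-1 (D (indicX R t)) ^+ 2 <= gamma * nrm (rank t) (indicX R t) ^+ 2.
Proof.
case/andP => t0 td; case et : (rank t) t0 td => [//|j] _ jd.
have ti : rank t == j.+1 by rewrite et.
rewrite /= sqr_nrm // -(ip_upX pi_ge0 measX _ _ jd) -et ip_point.
rewrite (sqr_nrm_point measX) mulrC ler_wpM2r //.
have := lazyX jd (exist _ t ti : level rank j.+1); rewrite /transition.
have -> : indic R (exist _ t ti : level rank j.+1) = res rank j.+1 (indicX R t).
  by apply/ffunP => u; rewrite !ffunE.
by rewrite downop_res upop_res ffunE.
Qed.

Lemma aw_weight_ge0 k (M : affine_walk R d k) : 0 <= aw_weight M.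
Proof. by apply: sumr_ge0. Qed.

Lemma expansion_bound k (M : affine_walk R d k) i (tau : level rank i) :
  (k < d)%N -> (0 < i <= k)%N -> stochastic (aw_op (rank := rank) nb pi M) ->
  `|expansion pi (aw_op nb pi M) (above k tau) - (1 - aw_eigenvalue M delta i)|
  <= (5 * (k * aw_height M * (aw_height M + k) * nbe nb k i))%:R
     * aw_weight M * gamma.
Proof.
move=> kd /andP[i0 ik] st; have [n kE] : exists n, k = (i + n)%N.
  by exists (k - i)%N; rewrite subnKC.
subst k; case: tau => t ti; set tau := exist _ _ _.
have /eqP iE := ti; subst i.
have td : (rank t <= d)%N := leq_trans ik (ltnW kd).
have pit : 0 < pi t by case: measX => _ pos _ _; apply: pos; apply: leq_ltn_trans kd.
have lz : nrm (rank t).-1 (D (indicX R t)) ^+ 2 <=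
    gamma * nrm (rank t) (indicX R t) ^+ 2.
  by apply: non_lazy_point; rewrite i0.
(* The sign of [gamma] follows from non-laziness at [t], where [pi t] is positive. *)
have gamma0 : 0 <= gamma.
  have := le_trans (sqr_ge0 _) lz.
  by rewrite (sqr_nrm_point measX) pmulr_lge0.
have [y ty ry] := exists_above measX (ltnW kd).
have N0 : (0 < nbe nb (rank t + n) (rank t))%N.
  by rewrite -ry; apply: (nbe_gt0 posetX ty).
set N := nbe _ _ _ in N0 *; set k := (rank t + n)%N in M st kd ry N N0 *.
set f := iter n U (indicX R t).
have ff : ip k f f = pi t / N%:R := ip_iter_up_point posetX measX (ltnW kd).
have NR : 0 < N%:R :> R by rewrite ltr0n.
have ff0 : 0 < ip k f f by rewrite ff divr_gt0.
pose E := N%:R *: f.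
have EE F G : ip k (N%:R *: F) (N%:R *: G) = N%:R ^+ 2 * ip k F G.
  by rewrite ipZl ipZr mulrA -expr2.
rewrite (expansionE (E := E)) //; first last.
- move=> x rx; rewrite ffunE /GRing.scale /= (iter_up_point R posetX) // mulrC.
  by rewrite -[nbe _ _ _]/N divfK // gt_eqF.
- by rewrite EE mulr_gt0 // exprn_gt0.
rewrite linearZ /= !EE -mulf_div divff ?mul1r; last by rewrite gt_eqF // exprn_gt0.
have -> (a b : R) : 1 - a - (1 - b) = b - a by ring.
rewrite distrC -(ler_pM2r ff0) -{2}(ger0_norm (ltW ff0)) -normrM mulrBl.
rewrite divfK ?gt_eqF // ip_affineX /aw_eigenvalue mulr_suml -sumrB.
apply: le_trans (ler_norm_sum _ _ _) _.
have -> : forall c w : R, c * w * gamma * ip k f f = w * (c * gamma * ip k f f).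
  by move=> c w; ring.
rewrite /aw_weight mulr_suml; apply: ler_sum => j _.
rewrite -(mulrA (aw_coef j)) -mulrBr normrM.
(* [aw_height] bounds the height only of walks with nonzero coefficient. *)
have [->|aj] := eqVneq (aw_coef j) 0; first by rewrite normr0 !mul0r.
rewrite ler_wpM2l //.
apply: le_trans (walk_rayleigh posetX measX eposetX gamma0 i0 td lz _ (ltnW kd)) _.
(* Passing from the squared norm [pi t] of the point to that of [f] brings the factor [N] into the
   bound. *)
rewrite (sqr_nrm_point measX) ff -/k [in leRHS]mulnA [in leRHS]natrM.
have -> (A : R) : A * N%:R * gamma * (pi t / N%:R) = A * gamma * pi t.
  by field; rewrite gt_eqF.
rewrite -!mulrA ler_wpM2r ?mulr_ge0 // ler_nat leq_mul2l /=.
have hj : (height (aw_walk j) <= aw_height M)%N by apply: leq_bigmax_cond.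
by rewrite leq_mul ?leq_mul2l ?hj ?orbT // leq_add2r.
Qed.

(** Nothing can be left: by regularity every element of rank [k] has, like [y0], an element of rank
    0 below it, and the only one is [tau]. *)
Lemma expansion_bottom k (M : affine_walk R d k) (tau : level rank 0) :
  (k <= d)%N -> expansion pi (aw_op nb pi M) (above k tau) = 0.
Proof.
move=> kd; have /eqP r0 := valP tau.
have [|y0 ty0 ry0] := @exists_above _ _ _ _ _ _ _ measX k (val tau).
  by rewrite r0.
rewrite /expansion (_ : ~: above k tau = set0).
  under eq_bigr do rewrite big_set0 mulr0.
  by rewrite big1 ?mul0r.
apply/setP => y; rewrite !inE; apply/negbTE; rewrite negbK.
have /eqP ry := valP y.
have : (0 < nbe nb (rank (val y)) 0)%N.
  by have := nbe_gt0 posetX ty0; rewrite ry0 r0 add0n ry.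
rewrite -(card_le_rank posetX) // => /card_gt0P[z]; rewrite inE => /andP[zy /eqP rz].
suff -> : val tau = z by [].
case: posetX => _ /eqP/cards1P[x0 E] _ _.
have in0 u : rank u = 0%N -> u = x0.
  by move=> ru; apply/set1P; rewrite -E inE ru.
by rewrite (in0 z) // (in0 (val tau)).
Qed.

Lemma aw_eigenvalue0 k (M : affine_walk R d k) : aw_eigenvalue M delta 0 = 1.
Proof.
rewrite -(aw_sum1 M); apply: eq_bigr => j _.
by rewrite /walk_eigenvalue big1 ?mulr1 // => s _; rewrite dltprod0 subr0.
Qed.

End Bound.

(* The bound on c is stated without division: where the denominator of the
   usual formulation vanishes, that bound is infinite. *)
Theorem theorem6p3 (R : realType) :
  exists C : R,
  forall (disp : Order.disp_t) (X : finPOrderType disp) (d : nat)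
    (rank : X -> nat) (nb : nat -> nat -> nat) (pi : X -> R)
    (delta : d.-1.-tuple R) (gamma : R),
  regular_graded_poset d rank nb ->
  measured d rank nb pi ->
  eposet rank nb pi delta gamma ->
  non_lazy d rank nb pi gamma ->
  forall (k : nat) (M : affine_walk R d k), (k < d)%N ->
  hd_walk rank nb pi M ->
  monotonic M delta ->
  forall (i : nat) (tau : level rank i), (i <= k)%N ->
  exists c : R,
    c * (dltprod delta k i * (1 - dlt delta i.-1)) <=
      C * k%:R ^+ 5 * (Rmax nb k)%:R ^+ 2 * (aw_height M + k)%:R
        * (aw_height M)%:R * aw_weight M /\
    expansion pi (aw_op nb pi M) (above k tau) \in
      `[1 - aw_eigenvalue M delta i - c * gamma,
        1 - aw_eigenvalue M delta i + c * gamma].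
Proof.
exists 5 => disp X d rank nb pi delta gamma posetX measX eposetX lazyX.
move=> k M kd [st _] _ [|i] tau ik.
  exists 0; split.
    by rewrite mul0r !mulr_ge0 ?exprn_ge0 ?aw_weight_ge0.
  rewrite (expansion_bottom posetX measX _ _ (ltnW kd)) aw_eigenvalue0.
  by rewrite mul0r subrr subr0 addr0 in_itv /= lexx.
exists ((5 * (k * aw_height M * (aw_height M + k) * nbe nb k i.+1))%:R
     * aw_weight M); split; last first.
  by rewrite in_itv /= -ler_distl; apply: (expansion_bound posetX).
have k0 : (0 < k)%N by apply: leq_ltn_trans ik.
have /andP[p0 p1] := dltprod_itv eposetX k i.+1.
have /andP[e0 e1] := dlt_itv eposetX i.
(* Both factors of the denominator lie in [0, 1], so multiplying by them only decreases [c]. *)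
apply: (@le_trans _ _ ((5 * (k * aw_height M * (aw_height M + k) *
    nbe nb k i.+1))%:R * aw_weight M)).
  rewrite ler_piMr ?mulr_ge0 ?aw_weight_ge0 // mulr_ile1 ?subr_ge0 //.
  by rewrite gerBl.
rewrite ler_wpM2r ?aw_weight_ge0 // -!natrX -!natrM ler_nat.
(* The leading factor [k] and the factor [nbe nb k i.+1] of [c] are now enlarged to the powers in
   the bound, [k] and [Rmax nb k] being at least 1. *)
have NR : (nbe nb k i.+1 <= Rmax nb k)%N.
  by apply: (nbe_le posetX measX) => //; rewrite k0 ltnW.
have R0 : (0 < Rmax nb k)%N.
  by apply: (Rmax_gt0 posetX measX); rewrite k0 ltnW.
have N2 : (nbe nb k i.+1 <= Rmax nb k ^ 2)%N.
  by apply: leq_trans NR _; rewrite expnS expn1 leq_pmulr.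
have k5 : (k <= k ^ 5)%N by rewrite -{1}[k]expn1 leq_pexp2l.
move: (k ^ 5)%N (Rmax nb k ^ 2)%N k5 N2 => P Q kP NQ.
have -> : (5 * P * Q * (aw_height M + k) * aw_height M =
  5 * (P * aw_height M * (aw_height M + k) * Q))%N by ring.
by rewrite !leq_mul.
Qed.
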